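(* Let $A\in\mathbb{R}^{n\times d}$, $b\in\mathbb{R}^n$ and $x^*=\arg\min_x\|Ax-b\|_2^2$. In the distributed iterative Hessian sketch algorithm (described in the context) with $q$ workers, set the step size $\mu=1/\theta_1$ and assume the $S_{t,k}\in\mathbb{R}^{m\times n}$ are i.i.d. Gaussian sketches. Then the expected squared norm of the error $e_t^A:=A(x_t-x^* )$ evolves according to the relation $$\mathbb{E}\big[\|e_{t+1}^A\|_2^2\big]=\frac1q\left(\frac{\theta_2}{\theta_1^2}-1\right)\|e_t^A\|_2^2,$$ where $$\theta_1:=\frac{m}{m-d-1},\qquad\theta_2:=\frac{m^2(m-1)}{(m-d)(m-d-1)(m-d-3)}.$$
   Context: Distributed iterative Hessian sketch: at each iteration $t$, each worker $k=1,\dots,q$, in parallel, obtains the sketched data $S_{t,k}A$, computes the gradient $g_t=A^T(Ax_t-b)$, solves $\hat{\Delta}_{t,k}=\arg\min_\Delta\frac12\|S_{t,k}A\Delta\|_2^2+g_t^T\Delta$ and sends it to the master node; the master node updates $x_{t+1}=x_t+\mu\frac1q\sum_{k=1}^q\hat{\Delta}_{t,k}$, i.e. $x_{t+1}=x_t-\mu\frac1q\sum_{k=1}^q(A^TS_{t,k}^TS_{t,k}A)^{-1}A^T(Ax_t-b)$. A Gaussian sketch is a random matrix $S\in\mathbb{R}^{m\times n}$ with i.i.d. zero-mean Gaussian entries, scaled so that $\mathbb{E}[S^TS]=I_n$ (that is, entries $\mathcal{N}(0,1/m)$). The expectation is over the sketches $S_{t,1},\dots,S_{t,q}$ of iteration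 $t$, with $x_t$ given; $A$ and $b$ are deterministic.
   Formalization: The formal theorem assumes that A has full column rank (implicit in the inverses), that q ≥ 1 and that m > d+3; without the last the claim fails, e.g. for m = d+2 the right-hand side is negative when e_t^A is nonzero. *)

(* Defs.v *)
From HB Require Import structures.
From mathcomp Require Import all_boot all_order all_algebra.
From mathcomp Require Import all_classical all_reals all_analysis.

Set Implicit Arguments.
Unset Strict Implicit.
Unset Printing Implicit Defensive.

Import Order.TTheory GRing.Theory Num.Theory.
Import numFieldNormedType.Exports.

Local Open Scope classical_set_scope.
Local Open Scope ring_scope.

(* Squared Euclidean norm; the norm [`|v|] that the library puts on matrices is
   the sup norm. *)
Definition sqnorm2 (R : realType) (n : nat) (v : 'cV[R]_n) : R :=
  \sum_(i < n) v i ord0 ^+ 2.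

(* [x] attains the minimum of [f]; uniqueness of the minimizer is not part of
   the definition. *)
Definition is_argmin (R : realType) (X : Type) (f : X -> R) (x : X) : Prop :=
  forall y, f x <= f y.

(* A random m x n matrix is given by its entries, which are bundled measurable
   functions; [mxval S w] is its realization at the outcome [w]. *)
Definition randmx (disp : measure_display) (T : measurableType disp)
    (R : realType) (P : probability T R) (m n : nat) : Type :=
  'I_m -> 'I_n -> {RV P >-> R}.

Definition mxval (disp : measure_display) (T : measurableType disp)
    (R : realType) (P : probability T R) (m n : nat) (S : randmx P m n) (w : T) :
    'M[R]_(m, n) :=
  \matrix_(i < m, j < n) S i j w.

(* The class of events determined by a real random variable, and the
   sigma-algebra generated by all the entries of a random matrix. *)
Definition rv_events (disp : measure_display) (T : measurableType disp)
    (R : realType) (P : probability T R) (X : {RV P >-> R}) : set (set T) :=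
  preimage_set_system setT X measurable.

Definition mx_events (disp : measure_display) (T : measurableType disp)
    (R : realType) (P : probability T R) (m n : nat) (S : randmx P m n) :
    set (set T) :=
  <<s \bigcup_(ij in [set: 'I_m * 'I_n]) rv_events (S ij.1 ij.2) >>.

(* Mutual independence of a finite family of classes of events: the product
   rule for every choice of events over every subfamily. *)
Definition mutually_independent (disp : measure_display)
    (T : measurableType disp) (R : realType) (P : probability T R)
    (I : finType) (F : I -> set (set T)) : Prop :=
  forall (J : {set I}) (E : I -> set T), (forall i, i \in J -> F i (E i)) ->
    P (\bigcap_(i in [set` J]) E i) = (\prod_(i in J) P (E i))%E.

(* I.i.d. entries N(0, 1/m), so that E[S^T S] = I_n; the second parameter of
   [normal_prob] is the standard deviation. *)
Definition gaussian_sketch (disp : measure_display) (T : measurableType disp)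
    (R : realType) (P : probability T R) (m n : nat) (S : randmx P m n) : Prop :=
  (forall i j (B : set R), measurable B ->
     distribution P (S i j) B = normal_prob 0 (Num.sqrt (m%:R^-1)) B) /\
  mutually_independent P
    (fun ij : 'I_m * 'I_n => rv_events (S ij.1 ij.2)).

(* All the sketches of the family have the same law by [gaussian_sketch]. *)
Definition iid_gaussian_sketches (disp : measure_display)
    (T : measurableType disp) (R : realType) (P : probability T R)
    (q m n : nat) (S : 'I_q -> randmx P m n) : Prop :=
  (forall k, gaussian_sketch (S k)) /\
  mutually_independent P (fun k => mx_events (S k)).

Definition ls_gradient (R : realType) (n d : nat) (A : 'M[R]_(n, d))
    (b : 'cV[R]_n) (x : 'cV[R]_d) : 'cV[R]_d :=
  A^T *m (A *m x - b).

(* The objective of a worker, where [SA] is its sketched data. *)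
Definition worker_objective (R : realType) (m d : nat) (SA : 'M[R]_(m, d))
    (g : 'cV[R]_d) (D : 'cV[R]_d) : R :=
  2^-1 * sqnorm2 (SA *m D) + (g^T *m D) ord0 ord0.

(* [D k] is the random vector that worker [k] sends to the master at the
   iterate [x].  It is required to minimize the objective almost surely: on the
   null event where [S k *m A] is not injective there need be no minimizer. *)
Definition worker_solutions (disp : measure_display) (T : measurableType disp)
    (R : realType) (P : probability T R) (q m n d : nat) (A : 'M[R]_(n, d))
    (b : 'cV[R]_n) (x : 'cV[R]_d) (S : 'I_q -> randmx P m n)
    (D : 'I_q -> randmx P d 1) : Prop :=
  forall k, {ae P, forall w,
    is_argmin (worker_objective (mxval (S k) w *m A) (ls_gradient A b x))
      (mxval (D k) w)}.

Definition master_update (R : realType) (q d : nat) (mu : R) (x : 'cV[R]_d)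
    (D : 'I_q -> 'cV[R]_d) : 'cV[R]_d :=
  x + (mu * q%:R^-1) *: \sum_(k < q) D k.

Definition theta1 (R : realType) (m d : nat) : R :=
  m%:R / (m%:R - d%:R - 1).

Definition theta2 (R : realType) (m d : nat) : R :=
  (m%:R ^+ 2 * (m%:R - 1)) /
  ((m%:R - d%:R) * (m%:R - d%:R - 1) * (m%:R - d%:R - 3)).

(* Main.v *)
Require Import Defs.
From HB Require Import structures.
From mathcomp Require Import all_boot all_order all_algebra.
From mathcomp Require Import all_classical all_reals all_analysis.
From mathcomp Require Import measurable_realfun ring lra.

Import Order.TTheory GRing.Theory Num.Theory.
Import numFieldNormedType.Exports.

Set Implicit Arguments.
Unset Strict Implicit.
Unset Printing Implicit Defensive.

Local Open Scope classical_set_scope.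
Local Open Scope ring_scope.

(** Write [e] for the current error [A (xt - xstar)], [B] for [S^T S], and [P]
    for the symmetric matrix [A (A^T B A)^-1 A^T].  By the normal equations the
    step of worker [k], seen in the column space of [A], is [- P_k e]
    ([worker_step]), so that the new error is [e - (mu / q) sum_k P_k e].  Let
    [Pi] be the orthogonal projection onto the column space.  Once
    [E P = theta1 Pi] ([mean_sketched_proj]) and [E P^2 = theta2 Pi]
    ([mean_sqr_sketched_proj]) are known, expanding the square and using the
    independence of the workers for the cross terms gives the recursion
    ([mean_sqnorm2_step]).

    The two moments, which are those of an inverse Wishart matrix, are obtained
    from Gaussian integration by parts: [E (S_ia f(S)) = m^-1 E (df/dS_ia)(S)]
    ([gaussian_stein]).  To make every function bounded and smooth, [P] is
    first replaced by [P_eps = A (A^T (B + eps) A)^-1 A^T].  Applying the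
    identity to the entries of [S P_eps], [S P_eps^2] and [tr(P_eps) S P_eps]
    yields linear relations between the means of [P], [P^2] and [tr(P) P], up
    to terms with a factor [eps] ([ridge_proj_moment1],
    [ridge_proj_moment2], [ridge_proj_moment3]).

    The traces of the same relations bound the second moment of [tr P_eps]
    uniformly in [eps] ([mean_sqr_tr_ridge_proj_le]); this is where
    [m > d + 3] enters.  As [tr P_eps] blows up when [S A] is not injective,
    that event is negligible ([ae_sketch_injective]); elsewhere [P_eps]
    increases to [P], and dominated convergence removes [eps].  The relations
    then read, with [k = m - d],
    [m Pi = (k - 1) E P], [m E P = (k - 2) E P^2 - E (tr(P) P)] and
    [m E (tr P) Pi = (k - 1) E (tr(P) P) - 2 E P^2], and they determine the two
    constants.  No change of basis is made: the law of [S A] is never needed. *)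

(** * Positive semidefinite matrices *)

Section PositiveSemidefinite.
Variable R : realType.

Definition quad_form n (M : 'M[R]_n) (u : 'cV[R]_n) : R := (u^T *m M *m u) 0 0.

Definition psd n (M : 'M[R]_n) : Prop :=
  M^T = M /\ forall u, 0 <= quad_form M u.

Lemma sqnorm2E n (v : 'cV[R]_n) : sqnorm2 v = (v^T *m v) 0 0.
Proof. by rewrite !mxE; apply: eq_bigr => i _; rewrite mxE expr2. Qed.

Lemma sqnorm2_ge0 n (v : 'cV[R]_n) : 0 <= sqnorm2 v.
Proof. by apply: sumr_ge0 => i _; exact: sqr_ge0. Qed.

Lemma sqnorm2_eq0 n (v : 'cV[R]_n) : (sqnorm2 v == 0) = (v == 0).
Proof.
apply/idP/eqP => [|->]; last by rewrite /sqnorm2 big1// => i _; rewrite mxE expr0n.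
rewrite psumr_eq0 => [/allP v0|i _]; last exact: sqr_ge0.
apply/colP => i; rewrite mxE.
by have := v0 i (mem_index_enum i); rewrite sqrf_eq0 => /eqP.
Qed.

Lemma psd_gram m n (X : 'M[R]_(m, n)) : psd (X^T *m X).
Proof.
split=> [|u]; first by rewrite trmx_mul trmxK.
by rewrite /quad_form !mulmxA -trmx_mul -mulmxA -sqnorm2E sqnorm2_ge0.
Qed.

Lemma psdD n (M N : 'M[R]_n) : psd M -> psd N -> psd (M + N).
Proof.
move=> [Ms Mp] [Ns Np]; split=> [|u]; first by rewrite linearD /= Ms Ns.
by rewrite /quad_form mulmxDr mulmxDl mxE addr_ge0 ?Mp ?Np.
Qed.

Lemma psdZ n (c : R) (M : 'M[R]_n) : 0 <= c -> psd M -> psd (c *: M).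
Proof.
move=> c0 [Ms Mp]; split=> [|u]; first by rewrite linearZ /= Ms.
by rewrite /quad_form -scalemxAr -scalemxAl mxE mulr_ge0 ?Mp.
Qed.

Lemma psd_congr m n (M : 'M[R]_n) (X : 'M[R]_(m, n)) :
  psd M -> psd (X *m M *m X^T).
Proof.
move=> [Ms Mp]; split=> [|u]; first by rewrite !trmx_mul trmxK Ms mulmxA.
by have := Mp (X^T *m u); rewrite /quad_form trmx_mul trmxK !mulmxA.
Qed.

Lemma quad_form_delta n (M : 'M[R]_n) i j (c : R) :
  quad_form M (delta_mx i 0 + c *: delta_mx j 0) =
  M i i + c * (M i j + M j i) + c ^+ 2 * M j j.
Proof.
have E a b : (((delta_mx a 0 : 'cV[R]_n)^T *m M) *m (delta_mx b 0 : 'cV[R]_n)) 0 0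
    = M a b.
  by rewrite trmx_delta -rowE -colE !mxE.
rewrite /quad_form [X in X *m M]raddfD /= [X in (_ + X) *m M]linearZ /=.
rewrite !mulmxDl !mulmxDr -!scalemxAl -!scalemxAr.
have DE (X Y : 'M[R]_1) : (X + Y) 0 0 = X 0 0 + Y 0 0 by rewrite mxE.
have ZE (a : R) (X : 'M[R]_1) : (a *: X) 0 0 = a * X 0 0 by rewrite mxE.
by rewrite !DE !ZE !E; ring.
Qed.

Lemma psd_diag_ge0 n (M : 'M[R]_n) i : psd M -> 0 <= M i i.
Proof.
move=> [_ /(_ (delta_mx i 0 + 0 *: delta_mx i 0))].
by rewrite quad_form_delta expr0n /= !mul0r !addr0.
Qed.

Lemma psd_diag_le_tr n (M : 'M[R]_n) i : psd M -> M i i <= \tr M.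
Proof.
move=> Mp; rewrite /mxtrace (bigD1 i)//= lerDl.
by apply: sumr_ge0 => j _; exact: psd_diag_ge0.
Qed.

Lemma psd_tr_ge0 n (M : 'M[R]_n) : psd M -> 0 <= \tr M.
Proof. by move=> Mp; apply: sumr_ge0 => j _; exact: psd_diag_ge0. Qed.

(** Testing the form on the sum and on the difference of two basis vectors
    bounds an entry by the mean of two diagonal entries. *)
Lemma psd_entry_le_tr n (M : 'M[R]_n) i j : psd M -> `|M i j| <= \tr M.
Proof.
move=> Mp; have [Ms Mq] := Mp.
have sij : M j i = M i j by rewrite -{1}Ms mxE.
have := Mq (delta_mx i 0 + 1 *: delta_mx j 0).
have := Mq (delta_mx i 0 + (- 1) *: delta_mx j 0).
rewrite !quad_form_delta sij => h1 h2.
have di := psd_diag_le_tr i Mp; have dj := psd_diag_le_tr j Mp.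
by rewrite ler_norml; apply/andP; split; nra.
Qed.

Lemma tr_gram_ge0 m n (X : 'M[R]_(m, n)) : 0 <= \tr (X^T *m X).
Proof. exact/psd_tr_ge0/psd_gram. Qed.

End PositiveSemidefinite.

(** * The regularized sketched projection *)

Definition ridge_gram (R : realType) m n d (A : 'M[R]_(n, d)) (e : R)
    (S : 'M[R]_(m, n)) : 'M[R]_d :=
  A^T *m (S^T *m S + e%:M) *m A.

(** At [e = 0] this is the matrix that governs the step of a worker.  It is
    locked so that reassociating products does not look inside it. *)
HB.lock Definition ridge_proj (R : realType) m n d (A : 'M[R]_(n, d)) (e : R)
    (S : 'M[R]_(m, n)) : 'M[R]_n :=
  A *m invmx (ridge_gram A e S) *m A^T.

HB.lock Definition orth_proj (R : realType) n d (A : 'M[R]_(n, d)) : 'M[R]_n :=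
  A *m invmx (A^T *m A) *m A^T.

Section RidgeProjection.
Variables (R : realType) (m n d : nat) (A : 'M[R]_(n, d)).
Implicit Types (S : 'M[R]_(m, n)) (e f : R).
Local Notation ridge_gram := (@ridge_gram R m n d A).
Local Notation ridge_proj := (@ridge_proj R m n d A).
Local Notation orth_proj := (@orth_proj R n d A).

Lemma ridge_projE e S :
  ridge_proj e S = A *m invmx (ridge_gram e S) *m A^T.
Proof. by rewrite unlock. Qed.

Lemma orth_projE : orth_proj = A *m invmx (A^T *m A) *m A^T.
Proof. by rewrite unlock. Qed.

Lemma ridge_gramE e S :
  ridge_gram e S = (S *m A)^T *m (S *m A) + e *: (A^T *m A).
Proof.
by rewrite /ridge_gram mulmxDr mulmxDl mul_mx_scalar -scalemxAl trmx_mul !mulmxA.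
Qed.

Lemma ridge_gram_sym e S : (ridge_gram e S)^T = ridge_gram e S.
Proof. by rewrite ridge_gramE raddfD /= linearZ /= !trmx_mul !trmxK. Qed.

Lemma ridge_proj_sym e S : (ridge_proj e S)^T = ridge_proj e S.
Proof.
by rewrite ridge_projE !trmx_mul trmxK trmx_inv ridge_gram_sym mulmxA.
Qed.

Lemma mul_ridge_projA e S : ridge_gram e S \in unitmx ->
  ridge_proj e S *m (S^T *m S + e%:M) *m A = A.
Proof.
move=> u; rewrite ridge_projE -!mulmxA (mulmxA A^T) -/(ridge_gram e S).
by rewrite mulVmx// mulmx1.
Qed.

Lemma mul_trA_ridge_proj e S : ridge_gram e S \in unitmx ->
  A^T *m (S^T *m S + e%:M) *m ridge_proj e S = A^T.
Proof.
by move=> u; rewrite ridge_projE !mulmxA -/(ridge_gram e S) mulmxV// mul1mx.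
Qed.

(** The resolvent identity; it gives at once the dependence of the matrix on
    the sketch (its derivative) and on the regularization (its monotonicity). *)
Lemma ridge_proj_resolvent e f S S' :
  ridge_gram e S \in unitmx -> ridge_gram f S' \in unitmx ->
  ridge_proj e S - ridge_proj f S' =
  ridge_proj e S *m ((S'^T *m S' + f%:M) - (S^T *m S + e%:M)) *m ridge_proj f S'.
Proof.
move=> u1 u2; rewrite mulmxBr mulmxBl; congr (_ - _).
- by rewrite (ridge_projE e) -!mulmxA (mulmxA A^T) mul_trA_ridge_proj.
- by rewrite (ridge_projE f) !mulmxA mul_ridge_projA.
Qed.

Lemma ridge_proj_sandwich e S : ridge_gram e S \in unitmx ->
  ridge_proj e S *m S^T *m S *m ridge_proj e S =
  ridge_proj e S - e *: (ridge_proj e S *m ridge_proj e S).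
Proof.
move=> u.
have E : ridge_proj e S *m (S^T *m S + e%:M) *m ridge_proj e S = ridge_proj e S.
  by rewrite {2 3}ridge_projE !mulmxA mul_ridge_projA.
by rewrite -{3}E mulmxDr mulmxDl mul_mx_scalar -scalemxAl !mulmxA addrK.
Qed.

(** Up to the regularization, [P (S^T S)] is an idempotent of rank [d]. *)
Lemma tr_sketch_ridge_proj e S : ridge_gram e S \in unitmx ->
  \tr (S *m ridge_proj e S *m S^T) = d%:R - e * \tr (ridge_proj e S).
Proof.
move=> u; apply/eqP; rewrite eq_sym subr_eq; apply/eqP.
rewrite mxtrace_mulC mulmxA -mxtraceZ -raddfD /= -mul_scalar_mx -mulmxDl.
rewrite {1}ridge_projE mxtrace_mulC -2!mulmxA mxtrace_mulC -!mulmxA.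
rewrite (mulmxA A^T) -/(ridge_gram e S).
by rewrite mulVmx// mxtrace1.
Qed.

Lemma ridge_proj_gramE e S : ridge_gram e S \in unitmx ->
  ridge_proj e S = (S *m ridge_proj e S)^T *m (S *m ridge_proj e S) +
                   e *: ((ridge_proj e S)^T *m ridge_proj e S).
Proof.
move=> u; rewrite trmx_mul ridge_proj_sym !mulmxA ridge_proj_sandwich//.
by rewrite subrK.
Qed.

Lemma ridge_proj_psd e S : 0 <= e -> ridge_gram e S \in unitmx ->
  psd (ridge_proj e S).
Proof.
move=> e0 u; rewrite ridge_proj_gramE//; apply: psdD; first exact: psd_gram.
by apply: psdZ => //; exact: psd_gram.
Qed.

Lemma tr_ridge_proj_le e S : 0 <= e -> ridge_gram e S \in unitmx ->
  e * \tr (ridge_proj e S) <= d%:R.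
Proof.
move=> e0 u; rewrite -subr_ge0 -tr_sketch_ridge_proj//.
by apply/psd_tr_ge0/psd_congr/ridge_proj_psd.
Qed.

(** Although [S] is unbounded, [S P] is bounded: its Gram matrix is below [P]. *)
Lemma sketch_ridge_proj_le e S i j : 0 <= e -> ridge_gram e S \in unitmx ->
  (S *m ridge_proj e S) i j ^+ 2 <= \tr (ridge_proj e S).
Proof.
move=> e0 u; have := psd_diag_le_tr j (ridge_proj_psd e0 u); apply: le_trans.
rewrite {2}ridge_proj_gramE// [leRHS]mxE; apply: ler_wpDr.
  by apply/psd_diag_ge0/psdZ => //; exact: psd_gram.
rewrite [leRHS]mxE (bigD1 i)//= [X in _ <= X * _ + _]mxE -expr2 lerDl.
by apply: sumr_ge0 => k _; rewrite mxE -expr2 sqr_ge0.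
Qed.

Lemma sketch_ridge_proj_sketch_le e S i j :
  0 <= e -> ridge_gram e S \in unitmx ->
  `|(S *m ridge_proj e S *m S^T) i j| <= d%:R.
Proof.
move=> e0 u; have p := ridge_proj_psd e0 u.
apply: (le_trans (psd_entry_le_tr i j (psd_congr S p))).
rewrite tr_sketch_ridge_proj// gerBl mulr_ge0//.
exact: psd_tr_ge0.
Qed.

(** By the resolvent identity the difference of the two traces is [f - e] times
    the trace of a product of two positive semidefinite matrices. *)
Lemma tr_ridge_proj_mono e f S : 0 <= e -> e <= f ->
  ridge_gram e S \in unitmx -> ridge_gram f S \in unitmx ->
  \tr (ridge_proj f S) <= \tr (ridge_proj e S).
Proof.
move=> e0 ef ue uf; rewrite -subr_ge0 -raddfB /=.
have f0 : 0 <= f by exact: le_trans ef.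
rewrite (ridge_proj_resolvent ue uf) opprD addrACA subrr add0r.
rewrite -raddfB /= mul_mx_scalar -scalemxAl mxtraceZ mulr_ge0 ?subr_ge0//.
rewrite mxtrace_mulC; set Pf := ridge_proj f S; set Pe := ridge_proj e S.
have pe : psd Pe by exact: ridge_proj_psd.
rewrite /Pf ridge_proj_gramE// -/Pf mulmxDl -scalemxAl raddfD /= addr_ge0//.
  rewrite -mulmxA mxtrace_mulC.
  exact/psd_tr_ge0/psd_congr.
rewrite mxtraceZ mulr_ge0// -mulmxA mxtrace_mulC.
exact/psd_tr_ge0/psd_congr.
Qed.

Hypothesis A_full : \rank A = d.

Lemma full_rank_inj p (X : 'M[R]_(d, p)) : A *m X = 0 -> X = 0.
Proof.
move=> AX0; have rf : row_free A^T by rewrite /row_free mxrank_tr A_full.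
apply: trmx_inj; rewrite trmx0; apply: (row_free_inj rf).
by rewrite -trmx_mul AX0 trmx0 mul0mx.
Qed.

Lemma unitmx_inj k (M : 'M[R]_k) :
  (forall v : 'cV[R]_k, M *m v = 0 -> v = 0) -> M \in unitmx.
Proof.
move=> inj; rewrite -unitmx_tr -row_free_unit; apply/row_freeP.
have /eqP ker0 : kermx M^T == 0.
  apply/eqP/row_matrixP => i; rewrite row0; apply: trmx_inj; rewrite trmx0.
  apply: inj; apply: trmx_inj; rewrite trmx_mul trmxK trmx0 -row_mul mulmx_ker.
  by rewrite row0.
by apply/row_freeP; rewrite -kermx_eq0 ker0.
Qed.

Lemma ridge_gram_unit e S : 0 < e -> ridge_gram e S \in unitmx.
Proof.
move=> e0; apply: unitmx_inj => v Wv.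
apply: full_rank_inj; apply/eqP; rewrite -sqnorm2_eq0.
have : (v^T *m (ridge_gram e S *m v)) 0 0 = 0 by rewrite Wv mulmx0 mxE.
rewrite ridge_gramE mulmxDl mulmxDr -scalemxAl -scalemxAr.
have -> : v^T *m ((S *m A)^T *m (S *m A) *m v) =
    (S *m A *m v)^T *m (S *m A *m v) by rewrite !trmx_mul !mulmxA.
have -> : v^T *m (A^T *m A *m v) = (A *m v)^T *m (A *m v).
  by rewrite !trmx_mul !mulmxA.
rewrite mxE [X in _ + X]mxE -!sqnorm2E => h.
rewrite eq_le sqnorm2_ge0 andbT.
have := sqnorm2_ge0 (S *m A *m v); have := sqnorm2_ge0 (A *m v); nra.
Qed.

Lemma gram_unit : A^T *m A \in unitmx.
Proof.
apply: unitmx_inj => v Wv; apply: full_rank_inj; apply/eqP.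
by rewrite -sqnorm2_eq0 sqnorm2E trmx_mul -mulmxA (mulmxA A^T) Wv mulmx0 mxE.
Qed.

Lemma orth_projA : orth_proj *m A = A.
Proof. by rewrite orth_projE -!mulmxA mulVmx ?mulmx1// gram_unit. Qed.

Lemma tr_orth_proj : \tr orth_proj = d%:R.
Proof.
by rewrite orth_projE mxtrace_mulC mulmxA mulmxV ?mxtrace1// gram_unit.
Qed.

Lemma orth_proj_ridge_proj e S : orth_proj *m ridge_proj e S = ridge_proj e S.
Proof. by rewrite ridge_projE !mulmxA orth_projA. Qed.

Lemma orth_proj_gram_ridge_proj e S : ridge_gram e S \in unitmx ->
  orth_proj *m (S^T *m (S *m ridge_proj e S)) = orth_proj - e *: ridge_proj e S.
Proof.
move=> u; apply/eqP; rewrite eq_sym subr_eq; apply/eqP.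
rewrite -{2}(orth_proj_ridge_proj e S) scalemxAr -mulmxDr -mul_scalar_mx.
rewrite (mulmxA S^T) -mulmxDl orth_projE -!mulmxA (mulmxA A^T).
by rewrite mul_trA_ridge_proj.
Qed.

(** On the singular event the regularized matrix has the eigenvalue [e^-1]:
    if [S A v = 0], then [A v] is an eigenvector. *)
Lemma singular_tr_ridge_proj S : ridge_gram 0 S \notin unitmx ->
  exists2 c : R, 0 < c & forall e, 0 < e -> c <= e * \tr (ridge_proj e S).
Proof.
move=> nu.
have [v v0 SAv] : exists2 v : 'cV[R]_d, v != 0 & S *m A *m v = 0.
  apply: contrapT => h; move/negP: nu; apply; apply: unitmx_inj => v Wv.
  apply: contrapT => /eqP v0; apply: h; exists v => //.
  apply/eqP; rewrite -sqnorm2_eq0 sqnorm2E.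
  move: Wv; rewrite ridge_gramE scale0r addr0 => Wv.
  by rewrite trmx_mul mulmxA -(mulmxA v^T) -(mulmxA v^T) Wv mulmx0 mxE.
pose u := A *m v.
have un0 : 0 < sqnorm2 u.
  rewrite lt_neqAle sqnorm2_ge0 andbT eq_sym sqnorm2_eq0.
  by apply: contra v0 => /eqP /full_rank_inj /eqP.
pose N := \sum_i \sum_j `|u i 0| * `|u j 0|.
have N0 : 0 <= N by apply: sumr_ge0 => i _; apply: sumr_ge0 => j _; rewrite mulr_ge0.
exists (sqnorm2 u / (N + 1)); first by rewrite divr_gt0 ?ltr_wpDl.
move=> e e0; have w := ridge_gram_unit S e0.
have Pu : e *: (ridge_proj e S *m u) = u.
  have := congr1 (mulmx^~ v) (mul_ridge_projA w).
  rewrite /= -!mulmxA -/u mulmxDl mul_scalar_mx -mulmxA.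
  by rewrite (mulmxA S) SAv mulmx0 add0r -scalemxAr.
have E : sqnorm2 u = e * quad_form (ridge_proj e S) u.
  by rewrite sqnorm2E -{2}Pu -scalemxAr mxE mulmxA.
rewrite ler_pdivrMr ?ltr_wpDl// E -mulrA ler_wpM2l ?(ltW e0)//.
have P := ridge_proj_psd (ltW e0) w.
apply: (@le_trans _ _ (\tr (ridge_proj e S) * N)); last first.
  by rewrite ler_wpM2l ?lerDl//; exact: psd_tr_ge0.
rewrite /quad_form mxE /N mulr_sumr; apply: ler_sum => j _.
rewrite mxE mulr_suml mulr_sumr; apply: ler_sum => k _.
rewrite (le_trans (ler_norm _))// !normrM [u^T 0 k]mxE.
rewrite [leLHS](_ : _ = `|ridge_proj e S k j| * (`|u j 0| * `|u k 0|)); last by ring.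
by rewrite ler_wpM2r ?mulr_ge0 ?psd_entry_le_tr.
Qed.

End RidgeProjection.

(** * Integration by parts against the normal density *)

Section NormalIntegral.
Variables (R : realType) (s : R).
Hypothesis s0 : s != 0.
Local Notation mu := (@lebesgue_measure R).
Local Notation pdf := (normal_pdf 0 s).
Local Notation nu := (normal_prob 0 s).

(** The density is a version of the Radon-Nikodym derivative. *)
Lemma ge0_integral_normal_prob (h : R -> \bar R) :
  (forall x, (0 <= h x)%E) -> measurable_fun [set: R] h ->
  (\int[nu]_x h x = \int[mu]_x (h x * (pdf x)%:E))%E.
Proof.
move=> h0 mh; have dom := normal_prob_dominates (0 : R) s.
rewrite -(Radon_Nikodym_SigmaFinite.change_of_variables dom)//.
have If := Radon_Nikodym_SigmaFinite.f_integrable dom.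
have mpdf : measurable_fun setT (fun x => (pdf x)%:E).
  by apply/measurable_EFinP; exact: measurable_normal_pdf.
apply: ae_eq_integral => //.
- by apply: emeasurable_funM => //; exact: measurable_int If.
- exact: emeasurable_funM.
- apply: ae_eqe_mul2l; apply: integral_ae_eq => //.
  by move=> E E01 mE; rewrite -Radon_Nikodym_SigmaFinite.f_integral.
Qed.

Lemma integrable_normal_prob (f : R -> R) : measurable_fun setT f ->
  mu.-integrable setT (fun x => (f x * pdf x)%:E) ->
  nu.-integrable setT (EFin \o f).
Proof.
move=> mf /integrableP[_ foo]; apply/integrableP; split; first exact/measurable_EFinP.
rewrite ge0_integral_normal_prob//; last first.
  by apply: measurableT_comp => //; exact/measurable_EFinP.
apply: le_lt_trans foo; rewrite le_eqVlt; apply/orP; left; apply/eqP.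
apply: eq_integral => x _; rewrite EFinM abseM; congr (_ * _)%E.
by rewrite gee0_abs// lee_fin normal_pdf_ge0.
Qed.

Lemma integral_normal_prob (f : R -> R) : measurable_fun setT f ->
  (\int[nu]_x (f x)%:E = \int[mu]_x (f x * pdf x)%:E)%E.
Proof.
move=> mf; rewrite integralE [RHS]integralE.
have mE : measurable_fun setT (EFin \o f) by exact/measurable_EFinP.
congr (_ - _)%E.
- rewrite ge0_integral_normal_prob//; last exact: measurable_funepos.
  apply: eq_integral => x _; rewrite !funeposE EFinM.
  by rewrite maxe_pMl ?mul0e// lee_fin normal_pdf_ge0.
- rewrite ge0_integral_normal_prob//; last exact: measurable_funeneg.
  apply: eq_integral => x _; rewrite !funenegE EFinM -mulNe.
  by rewrite maxe_pMl ?mul0e// lee_fin normal_pdf_ge0.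
Qed.

Lemma is_derive_normal_pdf x : is_derive x (1 : R) pdf (- (x / s ^+ 2) * pdf x).
Proof.
rewrite normal_pdfE//.
have -> : (fun x => normal_peak s * normal_fun 0 s x) =
    (normal_peak s) *: (expR \o (fun y : R => (- (s ^+ 2 *+ 2)^-1) *: (y ^+ 2))).
  apply/funext => y; rewrite /normal_fun/= subr0; congr (_ * expR _).
  by rewrite scaleNr mulNr mulrC.
apply: is_derive_eq.
rewrite /GRing.scale /= /normal_fun subr0 !mulr1.
rewrite (_ : - (s ^+ 2 *+ 2)^-1 * x ^+ 2 = - x ^+ 2 / (s ^+ 2 *+ 2)).
  by set E := expR _; rewrite -mulr_natr; field.
by rewrite -mulr_natr; field.
Qed.

(** The weight is absorbed by the Gaussian factor of a normal density with a
    larger standard deviation. *)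
Lemma normal_pdf_decay : exists2 C : R, 0 <= C &
  forall x, (1 + x ^+ 2) * pdf x <= C * normal_pdf 0 (2 * s) x.
Proof.
have s20 : 2 * s != 0 by rewrite mulf_neq0// pnatr_eq0.
have ss : 0 < s ^+ 2 by rewrite exprn_even_gt0.
pose M := 1 + 8 * s ^+ 2.
exists (normal_peak s / normal_peak (2 * s) * M) => [|x].
  by rewrite mulr_ge0 ?divr_ge0 ?normal_peak_ge0// /M; nra.
rewrite !normal_pdfE// /normal_fun subr0.
set a := expR _; set b := expR _.
have -> : a = b * expR (- (3 * x ^+ 2 / (8 * s ^+ 2))).
  rewrite /a /b -expRD; congr expR.
  by rewrite -(mulr_natr (s ^+ 2)) -(mulr_natr ((2 * s) ^+ 2)); field.
have pk := normal_peak_gt0 s0; have pk2 := normal_peak_gt0 s20.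
have h : 1 + x ^+ 2 <= M * expR (3 * x ^+ 2 / (8 * s ^+ 2)).
  apply: (@le_trans _ _ (M * (1 + 3 * x ^+ 2 / (8 * s ^+ 2)))).
    rewrite /M (_ : (1 + 8 * s ^+ 2) * (1 + 3 * x ^+ 2 / (8 * s ^+ 2)) =
      1 + 3 * x ^+ 2 + 8 * s ^+ 2 + 3 * x ^+ 2 / (8 * s ^+ 2)); last by field.
    have : 0 <= 3 * x ^+ 2 / (8 * s ^+ 2) by rewrite divr_ge0// mulr_ge0 ?sqr_ge0// ltW.
    have := sqr_ge0 x; nra.
  rewrite ler_wpM2l ?expR_ge1Dx// /M; nra.
have b0 : 0 < b by exact: expR_gt0.
rewrite expRN [leRHS](_ : _ = normal_peak s * b * M); last by field; rewrite gt_eqF.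
rewrite [leLHS](_ : _ = normal_peak s * b *
    ((1 + x ^+ 2) / expR (3 * x ^+ 2 / (8 * s ^+ 2)))); last by ring.
apply: ler_wpM2l; first by rewrite mulr_ge0// ltW.
by rewrite ler_pdivrMr ?expR_gt0.
Qed.

Lemma integrable_mul_normal_pdf (f : R -> R) K : measurable_fun [set: R] f ->
  (forall x, `|f x| <= K * (1 + x ^+ 2)) ->
  mu.-integrable setT (fun x => (f x * pdf x)%:E).
Proof.
move=> mf fK; have [C C0 CP] := normal_pdf_decay.
have K0 : 0 <= K.
  by have := le_trans (normr_ge0 _) (fK 0); rewrite expr0n addr0 mulr1.
have I := integrable_normal_pdf (0 : R) (2 * s).
have := integrableZl measurableT (K * C) I.
apply: le_integrable => //.
  apply/measurable_EFinP; apply: measurable_funM => //.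
  exact: measurable_normal_pdf.
move=> x _; rewrite -EFinM !abse_EFin lee_fin.
rewrite [leRHS]normrM [leLHS]normrM !(ger0_norm (normal_pdf_ge0 _ _ _)).
apply: (@le_trans _ _ (K * C * normal_pdf 0 (2 * s) x)); last first.
  by rewrite ler_wpM2r ?normal_pdf_ge0// ler_norm.
apply: (@le_trans _ _ (K * (1 + x ^+ 2) * pdf x)).
  by rewrite ler_wpM2r ?normal_pdf_ge0.
by rewrite -!mulrA ler_wpM2l.
Qed.

Lemma integrable_normal_prob_id : nu.-integrable setT (fun x : R => x%:E).
Proof.
apply: (@integrable_normal_prob id) => //.
apply: (@integrable_mul_normal_pdf id 1) => // x.
rewrite mul1r; have := sqr_ge0 (`|x| - 1); rewrite -[x ^+ 2]real_normK ?num_real//.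
have := normr_ge0 x; nra.
Qed.

Lemma normal_pdf_cvg0 (x : R ^nat) : (forall N, N%:R <= x N ^+ 2) ->
  pdf (x N) @[N --> \oo] --> (0 : R).
Proof.
move=> xN; have [C C0 CP] := normal_pdf_decay.
have s20 : 2 * s != 0 by rewrite mulf_neq0// pnatr_eq0.
apply: (@squeeze_cvgr _ _ _ _ (fun=> 0) (fun N => C * normal_peak (2 * s) * N.+1%:R^-1)).
- near=> N; rewrite normal_pdf_ge0/=.
  rewrite ler_pdivlMr// mulrC.
  apply: (@le_trans _ _ ((1 + x N ^+ 2) * pdf (x N))).
    by rewrite ler_wpM2r ?normal_pdf_ge0// -nat1r lerD2l.
  apply: (le_trans (CP _)); have := CP (x N).
  have := normal_pdf_ub 0 (x N) s20; have := normal_pdf_ge0 (0:R) (2 * s) (x N).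
  have := normal_pdf_ge0 (0:R) s (x N); have := sqr_ge0 (x N); nra.
- exact: cvg_cst.
- rewrite -[X in _ --> X](mulr0 (C * normal_peak (2 * s))).
  by apply: cvgM; [exact: cvg_cst|exact: cvg_harmonic].
Unshelve. all: by end_near. Qed.

Variables (phi phi' : R -> R) (K : R).
Hypothesis dphi : forall x, is_derive x (1 : R) phi (phi' x).
Hypothesis cphi' : continuous phi'.
Hypothesis phiK : forall x, `|phi x| <= K.
Hypothesis phi'K : forall x, `|phi' x| <= K.

Let K0 : 0 <= K. Proof. exact: le_trans (phiK 0). Qed.

Let cphi : continuous phi.
Proof.
move=> x; apply: differentiable_continuous; apply/derivable1_diffP.
exact: (@ex_derive _ _ _ _ _ _ _ (dphi x)).
Qed.

Let G x := (phi' x - phi x * x / s ^+ 2) * pdf x.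

Let cG : continuous G.
Proof.
move=> x; apply: cvgM; last exact: continuous_normal_pdf.
apply: cvgB; first exact: cphi'.
apply: cvgM; last exact: cvg_cst.
by apply: cvgM; [exact: cphi|exact: cvg_id].
Qed.

Let dF x : is_derive x (1 : R) (phi * pdf) (G x).
Proof.
have d1 := dphi x; have d2 := is_derive_normal_pdf x.
apply: is_derive_eq; rewrite /G /GRing.scale /=; field.
exact: s0.
Qed.

Let mphi : measurable_fun [set: R] phi.
Proof. exact: continuous_measurable_fun. Qed.

Let mphi' : measurable_fun [set: R] phi'.
Proof. exact: continuous_measurable_fun. Qed.

Let I1 : mu.-integrable setT (fun x => (phi' x * pdf x)%:E).
Proof.
apply: (@integrable_mul_normal_pdf _ K) => // x.
by rewrite (le_trans (phi'K x))// ler_peMr// lerDl sqr_ge0.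
Qed.

Let I2 : mu.-integrable setT (fun x => (x * phi x * pdf x)%:E).
Proof.
apply: (@integrable_mul_normal_pdf (fun x => x * phi x) K) => [|x].
  exact: measurable_funM.
rewrite normrM mulrC ler_pM//.
have := sqr_ge0 (`|x| - 1); rewrite -[x ^+ 2]real_normK ?num_real//.
have := normr_ge0 x; nra.
Qed.

Let IG : mu.-integrable setT (fun x => (G x)%:E).
Proof.
have := integrableB measurableT I1 (integrableZl measurableT (s ^- 2) I2).
apply: eq_integrable => // x _; rewrite -EFinM -EFinB /G; congr EFin.
by field.
Qed.

Let intG0 : (\int[mu]_x (G x)%:E = 0)%E.
Proof.
pose D (N : nat) : set R := [set` `[- N.+1%:R, N.+1%:R : R]].
have FTC N : (\int[mu]_(x in D N) (G x)%:E =
    (phi (N.+1%:R) * pdf N.+1%:R - phi (- N.+1%:R) * pdf (- N.+1%:R))%:E)%E.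
  rewrite (@continuous_FTC2 _ G (phi * pdf))//.
  - by rewrite (@lt_trans _ _ 0) ?oppr_lt0.
  - exact: continuous_subspaceT.
  - have cF : continuous (phi * pdf).
      move=> y; apply: differentiable_continuous; apply/derivable1_diffP.
      exact: (@ex_derive _ _ _ _ _ _ _ (dF y)).
    split=> [y _||].
    + exact: (@ex_derive _ _ _ _ _ _ _ (dF y)).
    + exact/cvg_at_right_filter/cF.
    + exact/cvg_at_left_filter/cF.
  - by move=> y _; rewrite derive1E; exact: (@derive_val _ _ _ _ _ _ _ (dF y)).
have lim0 : (\int[mu]_(x in D N) (G x)%:E @[N --> \oo] --> 0)%E.
  under eq_cvg do rewrite FTC.
  apply: cvg_EFin; first exact: nearW.
  rewrite -[X in _ --> X](subr0 0).
  have pN (e : R) : `|e| = 1 -> pdf (e * N.+1%:R) @[N --> \oo] --> (0 : R).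
    move=> e1; apply: (@normal_pdf_cvg0 (fun N => e * N.+1%:R)) => N.
    rewrite exprMn -[e ^+ 2]real_normK ?num_real// e1 expr1n mul1r.
    by rewrite -natrX ler_nat expnS expn1 (leq_trans (leqnSn N))// leq_pmulr.
  have bd (e : R) : `|e| = 1 -> phi (e * N.+1%:R) * pdf (e * N.+1%:R) @[N --> \oo] --> (0 : R).
    move=> e1; apply/cvgr0Pnorm_le => eps eps0.
    have /cvgr0Pnorm_le := pN e e1.
    move=> /(_ (eps / (K + 1))) []; first by rewrite divr_gt0 ?ltr_wpDl.
    move=> N0 _ hN; exists N0 => // N /= /hN /=.
    rewrite ler_pdivlMr ?ltr_wpDl// normrM => h; apply: le_trans h.
    by rewrite mulrC ler_wpM2l// (le_trans (phiK _))// lerDl.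
  apply: cvgB.
  - by have := bd 1 (normr1 _); under eq_cvg do rewrite mul1r.
  - have := bd (-1); rewrite normrN normr1 => /(_ erefl).
    by under eq_cvg do rewrite mulN1r.
have := @dominated_convergence _ _ _ mu setT measurableT
  (fun N x => ((G x)%:E * (\1_(D N) x)%:E)%E) (EFin \o G) (fun x => `|(G x)%:E|%E).
case.
- move=> N; apply: emeasurable_funM; first exact: measurable_int IG.
  by apply/measurable_EFinP; apply: measurable_indic; exact: measurable_itv.
- exact: measurable_int IG.
- apply: aeW => x _; apply: cvg_near_cst.
  near=> N; rewrite indicE mem_set ?mule1// /D /= in_itv /= -ler_norml.
  apply: (@le_trans _ _ N%:R); last by rewrite ler_nat.
  by near: N; exact: nbhs_infty_ger.
- exact: integrable_abse.
- apply: aeW => x N _; rewrite abseM -[leRHS]mule1 lee_wpmul2l//.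
  by rewrite abse_EFin lee_fin indicE; case: (_ \in _); rewrite ?normr0 ?normr1.
move=> _ _ cv; apply: cvg_unique cv _ => //=.
rewrite (_ : (fun N => _) = (fun N => \int[mu]_(x in D N) (G x)%:E)%E)//.
apply/funext => N; rewrite [RHS]integral_mkcond.
apply: eq_integral => x _; rewrite patchE indicE.
by case: (x \in D N); rewrite ?mule1 ?mule0.
Unshelve. all: by end_near. Qed.

Lemma integrable_normal_prob_mul : nu.-integrable setT (fun x => (x * phi x)%:E).
Proof.
by apply: (@integrable_normal_prob (fun x => x * phi x)) => //; exact: measurable_funM.
Qed.

(** The derivative of [phi * pdf] is [(phi' - x phi / s ^ 2) pdf], whose integral
    over the line vanishes because [phi * pdf] vanishes at infinity. *)
Lemma normal_prob_stein :
  \int[nu]_x (x * phi x) = s ^+ 2 * \int[nu]_x (phi' x).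
Proof.
rewrite /Rintegral !integral_normal_prob//; last exact: measurable_funM.
have := intG0; rewrite /G.
under eq_integral => x _.
  rewrite (_ : (phi' x - phi x * x / s ^+ 2) * pdf x =
     phi' x * pdf x - s ^- 2 * (x * phi x * pdf x)); last by field.
  over.
rewrite /= integralB_EFin//; last first.
  have := integrableZl measurableT (s ^- 2) I2; apply: eq_integrable => //.
under [X in (_ - X)%E]eq_integral do rewrite EFinM.
rewrite integralZl//.
have F1 := integrable_fin_num measurableT I1.
have F2 := integrable_fin_num measurableT I2.
move=> /(congr1 fine); rewrite fineB ?fin_numM// fineM//= => /eqP.
by rewrite subr_eq0 => /eqP ->; rewrite mulVKf// expf_neq0.
Qed.

End NormalIntegral.

(** * Independence and iterated integrals *)

Section Independence.
Variables (disp : measure_display) (T : measurableType disp) (R : realType).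
Variable P : probability T R.

Section Grouping.
Variables (I : finType) (F : I -> set (set T)).
Hypothesis F_measurable : forall i, F i `<=` measurable.
Hypothesis F_setI : forall i, setI_closed (F i).
Hypothesis F_setT : forall i, F i setT.
Hypothesis F_indep : mutually_independent P F.

(** The intersections of one event per class form a pi-system on which the
    product rule holds; a finite measure is determined by its values there. *)
Lemma mutually_independent_group (i0 : I) E0 E : F i0 E0 ->
  <<s \bigcup_(i in [set i | i != i0]) F i >> E ->
  (P (E0 `&` E) = P E0 * P E)%E.
Proof.
move=> FE0 GE.
have mE0 : measurable E0 by exact: (F_measurable FE0).
pose rest (e : I -> set T) := \bigcap_(i in [set i | i != i0]) e i.
pose G := [set A | exists2 e : I -> set T, (forall i, F i (e i)) & A = rest e].
have restE e : rest e = \bigcap_(i in [set` [set~ i0]%SET]) e i.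
    by apply: eq_bigcapl; split => i /=; rewrite !inE.
have G_meas : G `<=` measurable.
  move=> _ [e Fe ->]; apply: fin_bigcap_measurable; first exact: finite_finset.
  by move=> i _; exact: (F_measurable (Fe i)).
have G_setI : setI_closed G.
  move=> _ _ [e1 Fe1 ->] [e2 Fe2 ->]; exists (fun i => e1 i `&` e2 i).
    by move=> i; apply: F_setI.
  by rewrite /rest bigcapI.
have G_setT : G setT.
  by exists (fun=> setT) => [i|]; [exact: F_setT|rewrite /rest bigcapT].
have sub : <<s \bigcup_(i in [set i | i != i0]) F i >> `<=` <<s G >>.
  apply: smallest_sub; first exact: smallest_sigma_algebra.
  move=> A [i /= ii0 FA]; apply: sub_sigma_algebra.
  exists (fun j => if j == i then A else setT).
    by move=> j; case: eqP => [->//|_]; exact: F_setT.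
  apply/seteqP; split => [w Aw j /= _|w]; first by case: ifP.
  by move=> /(_ i ii0); rewrite eqxx.
have P0 : 0 <= fine (P E0) by rewrite fine_ge0.
pose m1 := mrestr P mE0.
pose m2 := mscale (NngNum P0) P.
have m12 A : G A -> m1 A = m2 A.
  move=> [e Fe ->]; rewrite /m1 /m2 /mrestr /mscale /= fineK ?fin_num_measure//.
  pose e' i := if i == i0 then E0 else e i.
  have Fe' i : F i (e' i) by rewrite /e'; case: eqP => [->|_].
  have Re : rest e = \bigcap_(i in [set` [set~ i0]%SET]) e' i.
    rewrite restE; apply: eq_bigcapr => i /=; rewrite !inE /e'.
    by move=> /negbTE ->.
  have -> : rest e `&` E0 = \bigcap_(i in [set` [set: I]%SET]) e' i.
    apply/seteqP; split => [w [rw E0w] i _|w h].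
      by rewrite /e'; case: eqP => // /eqP ii0; exact: rw.
    split; last by have := h i0; rewrite /e' eqxx; apply; rewrite /= inE.
    by move=> i /= ii0; have := h i; rewrite /e' (negbTE ii0); apply; rewrite /= inE.
  rewrite Re (F_indep (fun i _ => Fe' i)) (F_indep (fun i _ => Fe' i)).
  rewrite (bigD1 i0) ?inE//= {1}/e' eqxx; congr (_ * _)%E.
  by apply: eq_bigl => i; rewrite !inE.
have cover : \bigcup_(k : nat) [set: T] = setT.
  by apply/seteqP; split => // w _; exists 0%N.
have m1oo (k : nat) : (m1 setT < +oo)%E.
  by rewrite /m1 /mrestr setTI -ge0_fin_numE// fin_num_measure.
have := g_sigma_algebra_measure_unique G G_meas (fun=> setT) (fun=> G_setT)
  cover m1 m2 G_setI m12 m1oo E (sub _ GE).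
move=> mE; rewrite setIC -[LHS]/(mrestr P mE0 E) mE.
by rewrite -[LHS]/((fine (P E0))%:E * P E)%E fineK ?fin_num_measure.
Qed.

End Grouping.

Section JointLaw.
Variables (d1 d2 : measure_display) (T1 : measurableType d1).
Variables (T2 : measurableType d2) (X : {mfun T >-> T1}) (Y : {mfun T >-> T2}).
Hypothesis XY_indep : forall A B, measurable A -> measurable B ->
  (P (X @^-1` A `&` Y @^-1` B) = P (X @^-1` A) * P (Y @^-1` B))%E.

(** The joint law is the product of the marginal laws; then Fubini applies. *)
Lemma integral_indep (f : T1 * T2 -> \bar R) :
  measurable_fun setT f -> P.-integrable setT (fun w => f (X w, Y w)) ->
  (\int[P]_w f (X w, Y w) =
   \int[distribution P Y]_y \int[distribution P X]_x f (x, y))%E.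
Proof.
move=> mf If.
have mXY : measurable_fun setT (fun w => (X w, Y w)).
  by apply: measurable_fun_pair.
pose XYm := isMeasurableFun.Build _ _ _ _ _ mXY.
pose XY : {mfun T >-> (T1 * T2)%type} := HB.pack (fun w => (X w, Y w)) XYm.
have law A : measurable A ->
    (distribution P X \x distribution P Y)%E A = distribution P XY A.
  by apply: product_measure_unique => A1 A2 m1 m2; exact: XY_indep.
have Ipush : (distribution P XY).-integrable setT f.
  by apply: integrable_pushforward => //; rewrite preimage_setT.
rewrite -[LHS](@integral_distribution _ _ _ _ _ P XY)//.
rewrite (integral21_prod_meas1 (m1 := distribution P X) (m2 := distribution P Y)).
  by apply: eq_measure_integral => A mA _; exact/esym/law.
apply/integrableP; split=> //; move/integrableP : Ipush => [_].
congr (_ < _)%E; apply: eq_measure_integral => A mA _; exact/esym/law.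
Qed.

End JointLaw.

End Independence.

(** * Integration by parts against a Gaussian matrix *)

Section TameFunctions.
Variables (R : realType) (m n : nat).
Implicit Types f g : 'M[R]_(m, n) -> R.

(** Borel measurability is stated through composition with random matrices, so
    that no sigma-algebra on matrices is needed. *)
Definition mx_borel f := forall (disp : measure_display)
  (T : measurableType disp) (M : T -> 'M[R]_(m, n)),
  (forall i j, measurable_fun setT (fun w => M w i j)) ->
  measurable_fun setT (fun w => f (M w)).

Definition line_continuous f := forall (M E : 'M[R]_(m, n)),
  continuous (fun h : R => f (M + h *: E)).

(** The functions to which integration by parts is applied, and their
    derivatives; the class is closed under sums and products. *)
Definition tame f := [/\ mx_borel f, line_continuous f &
  exists K : R, forall M, `|f M| <= K].

Definition dir_derive (E : 'M[R]_(m, n)) f f' := forall M,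
  is_derive (0 : R) (1 : R) (fun h : R => f (M + h *: E)) (f' M).

Lemma tame_cst c : tame (fun=> c).
Proof.
split=> [? ? ? _||]; first exact: measurable_cst.
  by move=> M E h; exact: cvg_cst.
by exists `|c|.
Qed.

Lemma tameD f g : tame f -> tame g -> tame (fun M => f M + g M).
Proof.
move=> [bf cf [K fK]] [bg cg [L gL]]; split=> [? ? M mM||].
- by apply: measurable_funD; [exact: bf|exact: bg].
- by move=> M E h; apply: cvgD; [exact: cf|exact: cg].
- by exists (K + L) => M; rewrite (le_trans (ler_normD _ _))// lerD.
Qed.

Lemma tameM f g : tame f -> tame g -> tame (fun M => f M * g M).
Proof.
move=> [bf cf [K fK]] [bg cg [L gL]]; split=> [? ? M mM||].
- by apply: measurable_funM; [exact: bf|exact: bg].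
- by move=> M E h; apply: cvgM; [exact: cf|exact: cg].
- by exists (K * L) => M; rewrite normrM ler_pM.
Qed.

Lemma tameZ c f : tame f -> tame (fun M => c * f M).
Proof. by move=> tf; apply: tameM => //; exact: tame_cst. Qed.

Lemma tameN f : tame f -> tame (fun M => - f M).
Proof.
move=> tf; rewrite (_ : (fun M => - f M) = (fun M => -1 * f M)); last first.
  by apply/funext => M; rewrite mulN1r.
exact: tameZ.
Qed.

Lemma tame_sum (I : Type) (r : seq I) (F : I -> 'M[R]_(m, n) -> R) :
  (forall i, tame (F i)) -> tame (fun M => \sum_(i <- r) F i M).
Proof.
move=> tF; elim: r => [|i r IH].
  rewrite (_ : (fun M => _) = (fun=> 0)); first exact: tame_cst.
  by apply/funext => M; rewrite big_nil.
rewrite (_ : (fun M => _) = (fun M => F i M + \sum_(j <- r) F j M)); first exact: tameD.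
by apply/funext => M; rewrite big_cons.
Qed.

Lemma dir_deriveM E f g f' g' : dir_derive E f f' -> dir_derive E g g' ->
  dir_derive E (fun M => f M * g M) (fun M => f' M * g M + f M * g' M).
Proof.
move=> df dg M; have d1 := df M; have d2 := dg M.
have := is_deriveM d1 d2; rewrite scale0r addr0.
by rewrite [X in is_derive _ _ _ X]addrC /GRing.scale /= [g M * _]mulrC.
Qed.

Lemma dir_derive_sum E p (F F' : 'I_p -> 'M[R]_(m, n) -> R) :
  (forall i, dir_derive E (F i) (F' i)) ->
  dir_derive E (fun M => \sum_i F i M) (fun M => \sum_i F' i M).
Proof.
move=> dF M.
have := @is_derive_sum _ _ _ p (fun i (h : R) => F i (M + h *: E)) 0 1 (fun i => F' i M)
  (fun i => dF i M).
rewrite (_ : \sum_(i < p) _ = (fun h : R => \sum_i F i (M + h *: E)))//.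
by apply/funext => h; rewrite fct_sumE.
Qed.

(** The line through [M + x *: E] with direction [E] is a shift of the line
    through [M]. *)
Lemma dir_derive_at E f f' : dir_derive E f f' -> forall M (x : R),
  is_derive x (1 : R) (fun y : R => f (M + y *: E)) (f' (M + x *: E)).
Proof.
move=> df M x; have d0 := df (M + x *: E).
have dg : is_derive x (1 : R) (fun y : R => y - x) 1.
  by apply: is_derive_eq; rewrite subr0.
have e0 : x - x = 0 := subrr x.
rewrite -{1}e0 in d0.
have := @is_derive1_comp _ (fun h : R => f (M + x *: E + h *: E))
  (fun y : R => y - x) x _ _ d0 dg.
rewrite mulr1 /comp (_ : (fun y : R => _) = (fun y : R => f (M + y *: E)))//.
by apply/funext => y /=; rewrite -addrA -scalerDl addrCA subrr addr0.
Qed.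

End TameFunctions.

Lemma integrable_bounded (disp : measure_display) (T : measurableType disp)
  (R : realType) (P : probability T R) (f : T -> R) K : measurable_fun setT f ->
  (forall w, `|f w| <= K) -> P.-integrable setT (EFin \o f).
Proof.
move=> mf fK; apply: measurable_bounded_integrable => //.
  by rewrite (le_lt_trans (probability_le1 _ _))// ltry.
exists K; split; first exact: num_real.
by move=> x Kx w _ /=; rewrite (le_trans (fK w))// ltW.
Qed.

Section GaussianStein.
Variables (disp : measure_display) (T : measurableType disp) (R : realType).
Variables (P : probability T R) (m n : nat) (S : randmx P m n).
Hypothesis m_gt0 : (0 < m)%N.
Hypothesis S_gauss : gaussian_sketch S.

Lemma measurable_mxval i j : measurable_fun setT (fun w => mxval S w i j).
Proof.
by rewrite (_ : (fun w => _) = S i j)//; apply/funext => w; rewrite mxE.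
Qed.

Lemma integrable_tame (f : 'M[R]_(m, n) -> R) : tame f ->
  P.-integrable setT (fun w => (f (mxval S w))%:E).
Proof.
move=> [bf _ [K fK]]; apply: (@integrable_bounded _ _ _ _ _ K) => //.
by apply: bf => i j; exact: measurable_mxval.
Qed.

Lemma rv_events_measurable (X : {RV P >-> R}) : rv_events X `<=` measurable.
Proof. by move=> _ [B mB <-]; exact: measurable_funP. Qed.

Lemma rv_events_setI (X : {RV P >-> R}) : setI_closed (rv_events X).
Proof.
move=> _ _ [B mB <-] [C mC <-]; exists (B `&` C); first exact: measurableI.
by rewrite preimage_setI setIACA setIid.
Qed.

Lemma rv_events_setT (X : {RV P >-> R}) : rv_events X setT.
Proof. by exists setT => //; rewrite preimage_setT setIT. Qed.

Variables (i0 : 'I_m) (j0 : 'I_n).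

Let s : R := Num.sqrt (m%:R^-1).

Let s_neq0 : s != 0.
Proof. by rewrite gt_eqF// sqrtr_gt0 invr_gt0 ltr0n. Qed.

Let s2 : s ^+ 2 = m%:R^-1.
Proof. by rewrite sqr_sqrtr// invr_ge0. Qed.

(* The other entries are recorded by the identity of [T], seen as a random
   element of [T] with the sigma-algebra that they generate; no measurable
   structure on a space of matrices is needed. *)
Let others := \bigcup_(ij in [set ij | ij != (i0, j0)]) rv_events (S ij.1 ij.2).
Let T2 : measurableType _ := g_sigma_algebraType others.

Let others_measurable A : <<s others >> A -> measurable A.
Proof.
apply: smallest_sub; first exact: sigma_algebra_measurable.
by move=> B [ij _]; exact: rv_events_measurable.
Qed.

Let mY : measurable_fun (setT : set T) (id : T -> T2).
Proof. by move=> _ A mA; rewrite setTI; exact: others_measurable. Qed.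

Let Y : {mfun T >-> T2} := HB.pack (id : T -> T2) (isMeasurableFun.Build _ _ _ _ _ mY).

(* The law [normal_prob] lives on [measurableTypeR R], which has the Borel sets
   but not the display of [R]. *)
Let mX : measurable_fun (setT : set T) (S i0 j0 : T -> measurableTypeR R).
Proof. by move=> mT B mB; exact: (@measurable_funP _ _ _ _ setT (S i0 j0) mT B mB). Qed.

Let X : {mfun T >-> measurableTypeR R} :=
  HB.pack (S i0 j0 : T -> measurableTypeR R) (isMeasurableFun.Build _ _ _ _ _ mX).

Let indep A B : measurable A -> measurable B ->
  (P (X @^-1` A `&` Y @^-1` B) = P (X @^-1` A) * P (Y @^-1` B))%E.
Proof.
move=> mA mB; have [_ ind] := S_gauss.
apply: (mutually_independent_group _ _ _ ind (i0 := (i0, j0))).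
- by move=> ij; exact: rv_events_measurable.
- by move=> ij; exact: rv_events_setI.
- by move=> ij; exact: rv_events_setT.
- by exists A => //; rewrite setTI.
- exact: mB.
Qed.

Let rest (y : T2) : 'M[R]_(m, n) :=
  \matrix_(i, j) if (i, j) == (i0, j0) then 0 else S i j (y : T).

Let measurable_rest i j : measurable_fun setT (fun y : T2 => rest y i j).
Proof.
have [e|ne] := eqVneq (i, j) (i0, j0).
  rewrite (_ : (fun y => _) = (fun=> 0)); first exact: measurable_cst.
  by apply/funext => y; rewrite mxE e eqxx.
rewrite (_ : (fun y => _) = (fun y : T2 => S i j y)); last first.
  by apply/funext => y; rewrite mxE (negbTE ne).
move=> _ B mB; apply: sub_sigma_algebra; exists (i, j) => //.
by exists B.
Qed.

Let split_mx w : mxval S w = rest (Y w) + S i0 j0 w *: delta_mx i0 j0.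
Proof.
apply/matrixP => i j; rewrite !mxE -/(i == i0) xpair_eqE.
case: eqP => [->|_] /=; last by rewrite mulr0 addr0.
by case: eqP => [->|_] /=; rewrite ?mulr1 ?add0r// mulr0 addr0.
Qed.

Let measurable_line :
  forall i j, measurable_fun setT
    (fun z : measurableTypeR R * T2 => (rest z.2 + z.1 *: delta_mx i0 j0) i j).
Proof.
move=> i j.
rewrite (_ : (fun z => _) = (fun z : measurableTypeR R * T2 =>
    rest z.2 i j + z.1 * (delta_mx i0 j0 : 'M[R]_(m, n)) i j)).
  apply: measurable_funD.
    by apply: (measurableT_comp (measurable_rest i j)); exact: measurable_snd.
  by apply: measurable_funM => //; exact: measurable_fst.
by apply/funext => z; rewrite !mxE.
Qed.

Let law (g : R -> R) :
  (\int[distribution P X]_x (g x)%:E = \int[normal_prob 0 s]_x (g x)%:E)%E.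
Proof.
have [h _] := S_gauss; apply: (eq_measure_integral (normal_prob 0 s)) => B mB _.
exact: h.
Qed.

Lemma integrable_entry : P.-integrable setT (fun w => (S i0 j0 w)%:E).
Proof.
apply/integrableP; split; first exact/measurable_EFinP.
have /integrableP[_] := integrable_normal_prob_id s_neq0.
rewrite -[X in (X < _)%E](law (fun x => `|x|)).
by rewrite ge0_integral_distribution//; exact: measurableT_comp.
Qed.

Variables (f f' : 'M[R]_(m, n) -> R).
Hypothesis f_tame : tame f.
Hypothesis f'_tame : tame f'.
Hypothesis df : dir_derive (delta_mx i0 j0) f f'.

Lemma integrable_entry_tame :
  P.-integrable setT (fun w => (S i0 j0 w * f (mxval S w))%:E).
Proof.
have [bf _ [K fK]] := f_tame.
have := integrableZl measurableT K integrable_entry.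
apply: le_integrable => //.
  apply/measurable_EFinP; apply: measurable_funM => //.
  by apply: bf => i j; exact: measurable_mxval.
move=> w _; rewrite -EFinM !abse_EFin lee_fin !normrM mulrC ler_wpM2r//.
exact: le_trans (fK _) (ler_norm _).
Qed.

(** The entry [S i0 j0] is independent of the other ones.  Once these are fixed,
    the identity is the one-dimensional one along a line. *)
Lemma gaussian_stein :
  \int[P]_w (S i0 j0 w * f (mxval S w)) = m%:R^-1 * \int[P]_w f' (mxval S w).
Proof.
have [bf cf [K fK]] := f_tame; have [bf' cf' [L fL]] := f'_tame.
have EI y : ((\int[normal_prob 0 s]_x f' (rest y + x *: delta_mx i0 j0))%:E =
    \int[normal_prob 0 s]_x (f' (rest y + x *: delta_mx i0 j0))%:E)%E.
  rewrite /Rintegral fineK//; apply: integrable_fin_num => //.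
  apply: (@integrable_bounded _ _ _ _ _ L) => // .
  by apply: (@continuous_measurable_fun R); exact: cf'.
have E1 : (\int[P]_w (S i0 j0 w * f (mxval S w))%:E =
    \int[distribution P Y]_y
      (s ^+ 2 * \int[normal_prob 0 s]_x f' (rest y + x *: delta_mx i0 j0))%:E)%E.
  pose h (z : measurableTypeR R * T2) := (z.1 * f (rest z.2 + z.1 *: delta_mx i0 j0))%:E.
  rewrite (_ : (fun w => _) = (fun w => h (X w, Y w))); last first.
    by apply/funext => w; rewrite /h /= -split_mx.
  rewrite (integral_indep indep); last 2 first.
  - apply/measurable_EFinP; apply: measurable_funM; first exact: measurable_fst.
    exact: bf.
  - have := integrable_entry_tame; rewrite (_ : (fun w => _) = (fun w => h (X w, Y w)))//.
    by apply/funext => w; rewrite /h /= -split_mx.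
  apply: eq_integral => y _; rewrite /h /=.
  rewrite law; pose KL := Num.max K L.
  have B1 x : `|f (rest y + x *: delta_mx i0 j0)| <= KL by rewrite le_max fK.
  have B2 x : `|f' (rest y + x *: delta_mx i0 j0)| <= KL by rewrite le_max fL orbT.
  have dphi := dir_derive_at df (rest y).
  rewrite -(normal_prob_stein s_neq0 dphi (cf' _ _) B1 B2) /Rintegral fineK//.
  apply: integrable_fin_num => //.
  exact: (integrable_normal_prob_mul s_neq0 dphi B1).
have E2 : (\int[P]_w (f' (mxval S w))%:E =
    \int[distribution P Y]_y
      (\int[normal_prob 0 s]_x f' (rest y + x *: delta_mx i0 j0))%:E)%E.
  pose h (z : measurableTypeR R * T2) := (f' (rest z.2 + z.1 *: delta_mx i0 j0))%:E.
  rewrite (_ : (fun w => _) = (fun w => h (X w, Y w))); last first.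
    by apply/funext => w; rewrite /h /= -split_mx.
  rewrite (integral_indep indep); last 2 first.
  - by apply/measurable_EFinP; exact: bf'.
  - have := integrable_tame f'_tame; rewrite (_ : (fun w => _) = (fun w => h (X w, Y w)))//.
    by apply/funext => w; rewrite /h /= -split_mx.
  apply: eq_integral => y _; rewrite /h /= law.
  by rewrite EI.
have If' : (distribution P Y).-integrable setT (fun y =>
    (\int[normal_prob 0 s]_x f' (rest y + x *: delta_mx i0 j0))%:E).
  pose h (z : T2 * measurableTypeR R) :=
    (f' (rest z.1 + z.2 *: delta_mx i0 j0))%:E.
  have Ih : (distribution P Y \x normal_prob 0 s)%E.-integrable setT h.
    apply: measurable_bounded_integrable => //.
    - have := @product_measure1E _ _ _ _ _ (distribution P Y) (normal_prob 0 s)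
        setT setT measurableT measurableT.
      rewrite setXTT [X in (X * _)%E](probability_setT (distribution P Y)).
      rewrite [X in (_ * X)%E](probability_setT (normal_prob 0 s)) mule1 => e.
      by have : (1 < +oo :> \bar R)%E := ltry 1; rewrite -e.
    - apply: bf' => i j.
      have swap : measurable_fun setT (fun z : T2 * measurableTypeR R => (z.2, z.1)).
        by apply: measurable_fun_pair; [exact: measurable_snd|exact: measurable_fst].
      exact: (measurableT_comp (measurable_line i j) swap).
    - exists L; split; first exact: num_real.
      by move=> x Lx z _ /=; rewrite (le_trans (fL _))// ltW.
  have := integrable_fubini_F Ih; apply: eq_integrable => //.
rewrite /Rintegral E1 E2 -s2.
under eq_integral do rewrite EFinM.
rewrite integralZl// fineM//.
exact: integrable_fin_num.
Qed.

End GaussianStein.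

(** * Matrix-valued functions of the sketch *)

Section MeasurableMatrices.
Variables (disp : measure_display) (T : measurableType disp) (R : realType).

Definition mx_measurable p r (X : T -> 'M[R]_(p, r)) :=
  forall i j, measurable_fun setT (fun w => X w i j).

(** Real powers are measurable, and [x^-1 = x * (x ^ 2)^-1] also for [x <= 0]. *)
Lemma measurable_invr : measurable_fun [set: R] (fun x : R => x^-1).
Proof.
rewrite (_ : (fun x => _) = (fun x : R => x * ((x ^+ 2) `^ (-1)))); last first.
  apply/funext => x; rewrite powR_inv1 ?sqr_ge0//.
  by have [->|x0] := eqVneq x 0; [rewrite invr0 mul0r|field].
apply: measurable_funM => //.
have mX2 : measurable_fun [set: R] (fun x : R => x ^+ 2) by exact: measurable_funX.
exact: (measurableT_comp (measurable_powR (-1)) mX2).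
Qed.

Lemma mx_measurable_cst p r (C : 'M[R]_(p, r)) : mx_measurable (fun=> C).
Proof. by move=> i j; exact: measurable_cst. Qed.

Lemma mx_measurableD p r (X Y : T -> 'M[R]_(p, r)) :
  mx_measurable X -> mx_measurable Y -> mx_measurable (fun w => X w + Y w).
Proof.
by move=> mX mY i j; under eq_fun do rewrite mxE; exact: measurable_funD.
Qed.

Lemma mx_measurable_tr p r (X : T -> 'M[R]_(p, r)) :
  mx_measurable X -> mx_measurable (fun w => (X w)^T).
Proof. by move=> mX i j; under eq_fun do rewrite mxE; exact: mX. Qed.

Lemma mx_measurable_mul p r t (X : T -> 'M[R]_(p, r)) (Y : T -> 'M[R]_(r, t)) :
  mx_measurable X -> mx_measurable Y -> mx_measurable (fun w => X w *m Y w).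
Proof.
move=> mX mY i j; under eq_fun do rewrite mxE.
by apply: measurable_sum => k; exact: measurable_funM.
Qed.

Lemma measurable_det p (X : T -> 'M[R]_p) :
  mx_measurable X -> measurable_fun setT (fun w => \det (X w)).
Proof.
move=> mX; apply: measurable_sum => s.
apply: measurable_funM; first exact: measurable_cst.
by apply: measurable_prod => i _; exact: mX.
Qed.

Lemma mx_measurable_inv p (X : T -> 'M[R]_p) :
  mx_measurable X -> mx_measurable (fun w => invmx (X w)).
Proof.
move=> mX i j; have mdet := measurable_det mX.
rewrite (_ : (fun w => _) = (fun w => if \det (X w) == 0 then X w i j
    else (\det (X w))^-1 * ((-1) ^+ (j + i) * \det (row' j (col' i (X w)))))); last first.
  apply/funext => w; rewrite /invmx unitmxE unitfE.
  by case: eqP => //= _; rewrite !mxE /cofactor.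
apply: measurable_fun_ifT; [|exact: mX|].
- by apply: measurable_fun_eqr => //; exact: measurable_cst.
- apply: measurable_funM; first exact: (measurableT_comp measurable_invr).
  apply: measurable_funM; first exact: measurable_cst.
  by apply: measurable_det => k l; under eq_fun do rewrite !mxE; exact: mX.
Qed.

Lemma mx_measurable_ridge_proj m n d (A : 'M[R]_(n, d)) e (M : T -> 'M[R]_(m, n)) :
  mx_measurable M -> mx_measurable (fun w => ridge_proj A e (M w)).
Proof.
move=> mM; under eq_fun do rewrite ridge_projE.
apply: mx_measurable_mul; last exact: mx_measurable_cst.
apply: mx_measurable_mul; first exact: mx_measurable_cst.
apply: mx_measurable_inv.
apply: mx_measurable_mul; last exact: mx_measurable_cst.
apply: mx_measurable_mul; first exact: mx_measurable_cst.
apply: mx_measurableD; last exact: mx_measurable_cst.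
by apply: mx_measurable_mul => //; exact: mx_measurable_tr.
Qed.

End MeasurableMatrices.

Section MatrixFunctions.
Variables (R : realType) (m n : nat).

Definition mx_regular p r (F : 'M[R]_(m, n) -> 'M[R]_(p, r)) := forall i j,
  mx_borel (fun M => F M i j) /\ line_continuous (fun M => F M i j).

Definition mx_bounded p r (F : 'M[R]_(m, n) -> 'M[R]_(p, r)) := forall i j,
  exists K : R, forall M, `|F M i j| <= K.

Definition mx_tame p r (F : 'M[R]_(m, n) -> 'M[R]_(p, r)) := forall i j,
  tame (fun M => F M i j).

Definition mx_derive E p r (F F' : 'M[R]_(m, n) -> 'M[R]_(p, r)) := forall i j,
  dir_derive E (fun M => F M i j) (fun M => F' M i j).

Lemma mx_tameP p r (F : 'M[R]_(m, n) -> 'M[R]_(p, r)) :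
  mx_regular F -> mx_bounded F -> mx_tame F.
Proof. by move=> rF bF i j; have [b c] := rF i j; split=> //; exact: bF. Qed.

Lemma mx_tame_regular p r (F : 'M[R]_(m, n) -> 'M[R]_(p, r)) :
  mx_tame F -> mx_regular F.
Proof. by move=> tF i j; have [b c _] := tF i j. Qed.

Lemma mx_regular_id : mx_regular (fun M => M).
Proof.
move=> i j; split=> [? ? M mM|M E h]; first exact: mM.
under eq_fun do rewrite !mxE.
by apply: cvgD; [exact: cvg_cst|apply: cvgM; [exact: cvg_id|exact: cvg_cst]].
Qed.

Lemma mx_regular_mul p r t (F : 'M[R]_(m, n) -> 'M[R]_(p, r))
    (G : 'M[R]_(m, n) -> 'M[R]_(r, t)) :
  mx_regular F -> mx_regular G -> mx_regular (fun M => F M *m G M).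
Proof.
move=> rF rG i j; split=> [? ? M mM|M E h].
  under eq_fun do rewrite mxE.
  apply: measurable_sum => k; apply: measurable_funM.
    by have [b _] := rF i k; exact: b.
  by have [b _] := rG k j; exact: b.
under eq_fun do rewrite mxE.
apply: cvg_big => [|k _]; first exact: add_continuous.
apply: cvgM; first by have [_] := rF i k; exact.
by have [_] := rG k j; exact.
Qed.

Lemma mx_tame_cst p r (C : 'M[R]_(p, r)) : mx_tame (fun=> C).
Proof. by move=> i j; exact: tame_cst. Qed.

Lemma mx_tame_tr p r (F : 'M[R]_(m, n) -> 'M[R]_(p, r)) :
  mx_tame F -> mx_tame (fun M => (F M)^T).
Proof. by move=> tF i j; under eq_fun do rewrite mxE; exact: tF. Qed.

Lemma mx_tameD p r (F G : 'M[R]_(m, n) -> 'M[R]_(p, r)) :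
  mx_tame F -> mx_tame G -> mx_tame (fun M => F M + G M).
Proof. by move=> tF tG i j; under eq_fun do rewrite mxE; exact: tameD. Qed.

Lemma mx_tameZ p r (f : 'M[R]_(m, n) -> R) (F : 'M[R]_(m, n) -> 'M[R]_(p, r)) :
  tame f -> mx_tame F -> mx_tame (fun M => f M *: F M).
Proof. by move=> tf tF i j; under eq_fun do rewrite mxE; exact: tameM. Qed.

Lemma mx_tameN p r (F : 'M[R]_(m, n) -> 'M[R]_(p, r)) :
  mx_tame F -> mx_tame (fun M => - F M).
Proof. by move=> tF i j; under eq_fun do rewrite mxE; exact: tameN. Qed.

Lemma mx_tame_mul p r t (F : 'M[R]_(m, n) -> 'M[R]_(p, r))
    (G : 'M[R]_(m, n) -> 'M[R]_(r, t)) :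
  mx_tame F -> mx_tame G -> mx_tame (fun M => F M *m G M).
Proof.
move=> tF tG i j; under eq_fun do rewrite mxE.
by apply: tame_sum => k; exact: tameM.
Qed.

Lemma tame_mxtrace p (F : 'M[R]_(m, n) -> 'M[R]_p) :
  mx_tame F -> tame (fun M => \tr (F M)).
Proof. by move=> tF; apply: tame_sum => i; exact: tF. Qed.

Lemma mx_derive_mul E p r t (F F' : 'M[R]_(m, n) -> 'M[R]_(p, r))
    (G G' : 'M[R]_(m, n) -> 'M[R]_(r, t)) :
  mx_derive E F F' -> mx_derive E G G' ->
  mx_derive E (fun M => F M *m G M) (fun M => F' M *m G M + F M *m G' M).
Proof.
move=> dF dG i j.
have -> : (fun M => (F M *m G M) i j) = (fun M => \sum_k F M i k * G M k j).
  by apply/funext => M; rewrite mxE.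
have -> : (fun M => (F' M *m G M + F M *m G' M) i j) =
    (fun M => \sum_k (F' M i k * G M k j + F M i k * G' M k j)).
  by apply/funext => M; rewrite !mxE big_split.
by apply: dir_derive_sum => k; exact: dir_deriveM.
Qed.

Lemma dir_derive_mxtrace E p (F F' : 'M[R]_(m, n) -> 'M[R]_p) :
  mx_derive E F F' -> dir_derive E (fun M => \tr (F M)) (fun M => \tr (F' M)).
Proof. by move=> dF; apply: dir_derive_sum => i; exact: dF. Qed.

Lemma mx_deriveZ E p r (f f' : 'M[R]_(m, n) -> R)
    (F F' : 'M[R]_(m, n) -> 'M[R]_(p, r)) :
  dir_derive E f f' -> mx_derive E F F' ->
  mx_derive E (fun M => f M *: F M) (fun M => f' M *: F M + f M *: F' M).
Proof.
move=> df dF i j.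
have -> : (fun M => (f M *: F M) i j) = (fun M => f M * F M i j).
  by apply/funext => M; rewrite mxE.
have -> : (fun M => (f' M *: F M + f M *: F' M) i j) =
    (fun M => f' M * F M i j + f M * F' M i j).
  by apply/funext => M; rewrite !mxE.
exact: dir_deriveM.
Qed.

Lemma mx_derive_id E : mx_derive E (fun M => M) (fun=> E).
Proof.
move=> i j M; under eq_fun do rewrite !mxE.
by apply: is_derive_eq; rewrite /GRing.scale /= add0r mul1r mul0r add0r mulr1.
Qed.

Lemma line_continuous_at0 (f : 'M[R]_(m, n) -> R) :
  (forall M E, f (M + h *: E) @[h --> (0 : R)] --> f M) -> line_continuous f.
Proof.
move=> f0 M E h0.
have := f0 (M + h0 *: E) E; rewrite -(subrr h0) => c.
have sub : (h - h0) @[h --> h0] --> h0 - h0.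
  by apply: cvgB; [exact: cvg_id|exact: cvg_cst].
have := cvg_comp _ _ sub c.
rewrite /comp (_ : (fun h => _) = (fun h : R => f (M + h *: E)))//.
by apply/funext => h /=; rewrite -addrA -scalerDl addrCA subrr addr0.
Qed.

End MatrixFunctions.

(** * The sketched projection as a function of the sketch *)

Section MatrixLimits.
Variables (R : realType) (T : Type) (F : set_system T).
Context {FF : Filter F}.

Definition mx_cvg p r (X : T -> 'M[R]_(p, r)) (X0 : 'M[R]_(p, r)) :=
  forall i j, X t i j @[t --> F] --> X0 i j.

Lemma mx_cvg_cst p r (C : 'M[R]_(p, r)) : mx_cvg (fun=> C) C.
Proof. by move=> i j; exact: cvg_cst. Qed.

Lemma mx_cvgD p r (X Y : T -> 'M[R]_(p, r)) X0 Y0 :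
  mx_cvg X X0 -> mx_cvg Y Y0 -> mx_cvg (fun t => X t + Y t) (X0 + Y0).
Proof.
by move=> cX cY i j; under eq_cvg do rewrite mxE; rewrite mxE; exact: cvgD.
Qed.

Lemma mx_cvgN p r (X : T -> 'M[R]_(p, r)) X0 :
  mx_cvg X X0 -> mx_cvg (fun t => - X t) (- X0).
Proof. by move=> cX i j; under eq_cvg do rewrite mxE; rewrite mxE; exact: cvgN. Qed.

Lemma mx_cvgZ p r (f : T -> R) (X : T -> 'M[R]_(p, r)) (f0 : R) X0 :
  f t @[t --> F] --> f0 -> mx_cvg X X0 -> mx_cvg (fun t => f t *: X t) (f0 *: X0).
Proof.
by move=> cf cX i j; under eq_cvg do rewrite mxE; rewrite mxE; exact: cvgM.
Qed.

Lemma mx_cvg_mul p r s (X : T -> 'M[R]_(p, r)) (Y : T -> 'M[R]_(r, s)) X0 Y0 :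
  mx_cvg X X0 -> mx_cvg Y Y0 -> mx_cvg (fun t => X t *m Y t) (X0 *m Y0).
Proof.
move=> cX cY i j; under eq_cvg do rewrite mxE; rewrite mxE.
by apply: cvg_big => [|k _]; [exact: add_continuous|exact: cvgM].
Qed.

Lemma cvg_mxtrace p (X : T -> 'M[R]_p) X0 :
  mx_cvg X X0 -> \tr (X t) @[t --> F] --> \tr X0.
Proof.
by move=> cX; apply: cvg_big => [|k _]; [exact: add_continuous|exact: cX].
Qed.

Lemma cvg0_bounded_mul (f g : T -> R) K : (forall t, `|f t| <= K) ->
  g t @[t --> F] --> (0 : R) -> f t * g t @[t --> F] --> (0 : R).
Proof.
move=> fK g0; apply/norm_cvg0P.
apply: (@squeeze_cvgr _ _ _ _ (fun=> 0) (fun t => K * `|g t|)).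
- by apply: nearW => t; rewrite normr_ge0 normrM ler_wpM2r.
- exact: cvg_cst.
- rewrite -[X in _ --> X](mulr0 K); apply: cvgM; first exact: cvg_cst.
  by apply/norm_cvg0P.
Qed.

End MatrixLimits.

Section RidgeCalculus.
Variables (R : realType) (m n d : nat) (A : 'M[R]_(n, d)) (e : R).
Hypothesis A_full : \rank A = d.
Hypothesis e_gt0 : 0 < e.
Local Notation proj := (ridge_proj A e).

Let Wu (M : 'M[R]_(m, n)) : ridge_gram A e M \in unitmx.
Proof. exact: ridge_gram_unit. Qed.

Lemma tr_ridge_proj_ub (M : 'M[R]_(m, n)) : \tr (proj M) <= d%:R / e.
Proof. by rewrite ler_pdivlMr// mulrC tr_ridge_proj_le// ltW. Qed.

Lemma ridge_proj_bounded : mx_bounded (fun M : 'M[R]_(m, n) => proj M).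
Proof.
move=> i j; exists (d%:R / e) => M; apply: le_trans (tr_ridge_proj_ub M).
by apply/psd_entry_le_tr/ridge_proj_psd => //; exact: ltW.
Qed.

Let incr (M E : 'M[R]_(m, n)) (h : R) : 'M[R]_n :=
  (E^T *m M + M^T *m E) + h *: (E^T *m E).

Let ridge_proj_line (M E : 'M[R]_(m, n)) h :
  proj (M + h *: E) - proj M = - (h *: (proj (M + h *: E) *m incr M E h *m proj M)).
Proof.
have E1 : (M + h *: E)^T *m (M + h *: E) = M^T *m M + h *: incr M E h.
  rewrite [X in X *m _]raddfD /= [X in (_ + X) *m _]linearZ /=.
  rewrite mulmxDl !mulmxDr -!scalemxAl -!scalemxAr.
  by rewrite /incr !scalerDr -!addrA; congr (_ + _); rewrite addrCA.
rewrite (ridge_proj_resolvent (Wu _) (Wu _)) E1 opprD addrACA subrr addr0.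
by rewrite opprD addrA subrr sub0r mulmxN mulNmx -scalemxAr -scalemxAl.
Qed.

(** The increment along a line is [h] times a product of three factors that stay
    bounded as [h] tends to zero. *)
Lemma ridge_proj_regular : mx_regular (fun M : 'M[R]_(m, n) => proj M).
Proof.
move=> i j; split=> [disp T M mM|].
  exact: (mx_measurable_ridge_proj A e mM).
apply: line_continuous_at0 => M E.
have -> : (fun h : R => proj (M + h *: E) i j) =
    (fun h => \sum_k proj (M + h *: E) i k * (- (h *: (incr M E h *m proj M)) k j) +
       proj M i j).
  apply/funext => h; apply/eqP; rewrite -subr_eq; apply/eqP.
  have := ridge_proj_line M E h => /matrixP /(_ i j).
  rewrite mxE [X in _ + X]mxE => ->; rewrite -mulmxA scalemxAr -mulmxN mxE.
  by apply: eq_bigr => k _; rewrite [X in _ * X = _]mxE.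
rewrite -[X in _ --> X]add0r; apply: cvgD; last exact: cvg_cst.
have s0 : \sum_(k < n) (0 : R) = 0 by rewrite big1.
rewrite -[X in _ --> X]s0.
apply: cvg_big => [|k _]; first exact: add_continuous.
have [K PK] := ridge_proj_bounded i k.
apply: (@cvg0_bounded_mul _ _ _ _ _ _ K) => //.
rewrite -[X in _ --> X]oppr0; apply: cvgN.
have : mx_cvg (nbhs (0 : R)) (fun h : R => h *: (incr M E h *m proj M))
    (0 *: (incr M E 0 *m proj M)).
  apply: mx_cvgZ; first exact: cvg_id.
  apply: mx_cvg_mul; last exact: mx_cvg_cst.
  apply: mx_cvgD; first exact: mx_cvg_cst.
  by apply: mx_cvgZ; [exact: cvg_id|exact: mx_cvg_cst].
by move=> /(_ k j); rewrite scale0r [X in _ --> X]mxE.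
Qed.

Lemma ridge_proj_tame : mx_tame (fun M : 'M[R]_(m, n) => proj M).
Proof. exact: mx_tameP ridge_proj_regular ridge_proj_bounded. Qed.

(** The resolvent identity is an exact first order expansion, as required by
    the criterion of Caratheodory. *)
Lemma ridge_proj_derive (E : 'M[R]_(m, n)) :
  mx_derive E (fun M => proj M)
    (fun M => - (proj M *m (E^T *m M + M^T *m E) *m proj M)).
Proof.
move=> i j M; apply/is_derive1_caratheodory.
exists (fun h : R => (- (proj (M + h *: E) *m incr M E h *m proj M)) i j); split.
- move=> h; rewrite scale0r addr0 subr0.
  have := ridge_proj_line M E h => /matrixP /(_ i j).
  rewrite mxE [X in _ + X]mxE => ->; rewrite !mxE -mulNr mulrC.
  by rewrite mulrN mulNr mulrC.
- have : mx_cvg (nbhs (0 : R)) (fun h : R => - (proj (M + h *: E) *m incr M E h *m proj M))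
      (- (proj (M + 0 *: E) *m incr M E 0 *m proj M)).
    apply: mx_cvgN; apply: mx_cvg_mul; last exact: mx_cvg_cst.
    apply: mx_cvg_mul.
      by move=> k l; have [_] := ridge_proj_regular k l; exact.
    apply: mx_cvgD; first exact: mx_cvg_cst.
    by apply: mx_cvgZ; [exact: cvg_id|exact: mx_cvg_cst].
  by move=> /(_ i j).
- by rewrite /incr !scale0r !addr0.
Qed.

End RidgeCalculus.

(** * Moment identities of the regularized projection *)

Section RintegralSum.
Variables (disp : measure_display) (T : measurableType disp) (R : realType).
Variable mu : {measure set T -> \bar R}.

Lemma integrable_Rsum (I : Type) (r : seq I) (f : I -> T -> R) :
  (forall i, mu.-integrable setT (EFin \o f i)) ->
  mu.-integrable setT (EFin \o (fun w => \sum_(i <- r) f i w)).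
Proof.
move=> If; elim: r => [|i r IH].
  apply: (eq_integrable measurableT (cst 0%E)); last exact: integrable0.
  by move=> w _ /=; rewrite big_nil.
have := integrableD measurableT (If i) IH; apply: eq_integrable => // w _.
by rewrite /= big_cons.
Qed.

Lemma Rintegral_sum (I : Type) (r : seq I) (f : I -> T -> R) :
  (forall i, mu.-integrable setT (EFin \o f i)) ->
  \int[mu]_w (\sum_(i <- r) f i w) = \sum_(i <- r) \int[mu]_w f i w.
Proof.
move=> If; elim: r => [|i r IH].
  rewrite big_nil; under eq_Rintegral do rewrite big_nil.
  by rewrite /Rintegral integral0.
rewrite big_cons -IH -RintegralD//; last exact: integrable_Rsum.
by apply: eq_Rintegral => w _; rewrite big_cons.
Qed.

Lemma integrable_RZ (c : R) (f : T -> R) :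
  mu.-integrable setT (EFin \o f) ->
  mu.-integrable setT (EFin \o (fun w => c * f w)).
Proof. by move=> If; have := integrableZl measurableT c If; apply: eq_integrable. Qed.

End RintegralSum.

Section MatrixStein.
Variables (disp : measure_display) (T : measurableType disp) (R : realType).
Variables (P : probability T R) (m n : nat) (S : randmx P m n).
Hypothesis m_gt0 : (0 < m)%N.
Hypothesis S_gauss : gaussian_sketch S.

(** Here [div M a b] is the divergence, with respect to the column [a] of the
    matrix variable, of the column [b] of [F].  The factor [C] will be a
    projection that simplifies the left-hand side. *)
Lemma matrix_stein p (C : 'M[R]_(p, n)) (F : 'M[R]_(m, n) -> 'M[R]_(m, n))
    (F' : 'I_m -> 'I_n -> 'M[R]_(m, n) -> 'M[R]_(m, n))
    (div : 'M[R]_(m, n) -> 'M[R]_n) :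
  mx_tame F -> (forall i a, mx_tame (F' i a)) ->
  (forall i a, mx_derive (delta_mx i a) F (F' i a)) ->
  (forall M a b, div M a b = \sum_i F' i a M i b) ->
  forall c b, \int[P]_w (C *m ((mxval S w)^T *m F (mxval S w))) c b =
    m%:R^-1 * \int[P]_w (C *m div (mxval S w)) c b.
Proof.
move=> tF tF' dF divE c b.
have I1 i a : P.-integrable setT
    (EFin \o (fun w => C c a * (S i a w * F (mxval S w) i b))).
  by apply: integrable_RZ; exact: (integrable_entry_tame m_gt0 S_gauss _ _ (tF i b)).
have I2 i a : P.-integrable setT
    (EFin \o (fun w => C c a * F' i a (mxval S w) i b)).
  by apply: integrable_RZ; exact: (integrable_tame S (tF' i a i b)).
have -> : \int[P]_w (C *m ((mxval S w)^T *m F (mxval S w))) c b =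
    \int[P]_w \sum_a \sum_i C c a * (S i a w * F (mxval S w) i b).
  apply: eq_Rintegral => w _; rewrite mxE; apply: eq_bigr => a _.
  rewrite mxE mulr_sumr; apply: eq_bigr => i _.
  by rewrite [_^T _ _]mxE [mxval _ _ _ _]mxE.
have -> : \int[P]_w (C *m div (mxval S w)) c b =
    \int[P]_w \sum_a \sum_i C c a * F' i a (mxval S w) i b.
  apply: eq_Rintegral => w _; rewrite mxE; apply: eq_bigr => a _.
  by rewrite divE mulr_sumr.
rewrite !Rintegral_sum => [|a|a]; [|exact: integrable_Rsum|exact: integrable_Rsum].
rewrite mulr_sumr; apply: eq_bigr => a _.
rewrite !Rintegral_sum// mulr_sumr; apply: eq_bigr => i _.
rewrite !RintegralZl//; last 2 first.
- exact: (integrable_tame S (tF' i a i b)).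
- exact: (integrable_entry_tame m_gt0 S_gauss _ _ (tF i b)).
rewrite mulrCA; congr (_ * _).
exact: (gaussian_stein m_gt0 S_gauss (tF i b) (tF' i a i b) (dF i a i b)).
Qed.

End MatrixStein.

Section RidgeMoments.
Variables (disp : measure_display) (T : measurableType disp) (R : realType).
Variables (P : probability T R) (m n d : nat) (S : randmx P m n).
Hypothesis m_gt0 : (0 < m)%N.
Hypothesis S_gauss : gaussian_sketch S.
Variables (A : 'M[R]_(n, d)) (e : R).
Hypothesis A_full : \rank A = d.
Hypothesis e_gt0 : 0 < e.

Let p (M : 'M[R]_(m, n)) := ridge_proj A e M.
Let q (M : 'M[R]_(m, n)) := M *m p M.
Let r (M : 'M[R]_(m, n)) := M *m p M *m M^T.
Let t (M : 'M[R]_(m, n)) := \tr (p M).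

Let u (M : 'M[R]_(m, n)) : ridge_gram A e M \in unitmx.
Proof. exact: ridge_gram_unit. Qed.

Let p_tame : mx_tame p.
Proof. exact: ridge_proj_tame. Qed.

Let p_sym M : (p M)^T = p M.
Proof. exact: ridge_proj_sym. Qed.

Let q_tame : mx_tame q.
Proof.
apply: mx_tameP => [|i j].
  apply: mx_regular_mul; first exact: mx_regular_id.
  exact/mx_tame_regular/p_tame.
exists (1 + d%:R / e) => M.
have h := sketch_ridge_proj_le i j (ltW e_gt0) (u M).
have h2 := tr_ridge_proj_ub A_full e_gt0 M.
have := le_trans h h2; rewrite -/(p M) -/(q M) => h3.
move: h3; rewrite -[q M i j ^+ 2]real_normK ?num_real//.
have x0 : 0 <= d%:R / e by rewrite divr_ge0// ltW.
have := sqr_ge0 (`|q M i j| - 1); nra.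
Qed.

Let r_tame : mx_tame r.
Proof.
apply: mx_tameP => [|i j].
  apply: mx_regular_mul; first exact: mx_tame_regular.
  move=> a b; have [h1 h2] := @mx_regular_id R m n b a; split.
    move=> d0 T0 M mM; have := h1 _ _ M mM.
    by under [X in _ -> measurable_fun _ X]eq_fun do rewrite mxE.
  by move=> M E; have := h2 M E; under [X in _ -> continuous X]eq_fun do rewrite mxE.
by exists d%:R => M; exact: sketch_ridge_proj_sketch_le (ltW e_gt0) (u M).
Qed.

Let t_tame : tame t.
Proof. exact: tame_mxtrace. Qed.

Let qTq M : (q M)^T *m q M = p M - e *: (p M *m p M).
Proof. by rewrite /q trmx_mul p_sym !mulmxA; exact: ridge_proj_sandwich. Qed.

Let tr_r M : \tr (r M) = d%:R - e * t M.
Proof. exact: tr_sketch_ridge_proj. Qed.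

(* The directional derivatives of [p] and [q]; written with [p], [q] and [r]
   only, they are visibly bounded. *)
Let p' E M : 'M[R]_n := - (p M *m E^T *m q M + (q M)^T *m E *m p M).
Let q' E M : 'M[R]_(m, n) := E *m p M - q M *m E^T *m q M - r M *m E *m p M.

Let dp E : mx_derive E p (p' E).
Proof.
have -> : p' E = (fun M => - (p M *m (E^T *m M + M^T *m E) *m p M)).
  apply/funext => M; rewrite /p' /q trmx_mul p_sym mulmxDr mulmxDl.
  by rewrite !mulmxA.
exact: ridge_proj_derive.
Qed.

Let dq E : mx_derive E q (q' E).
Proof.
have -> : q' E = (fun M => E *m p M + M *m p' E M).
  apply/funext => M; rewrite /q' /p' /q /r mulmxN mulmxDr trmx_mul p_sym.
  by rewrite opprD !mulmxA addrA.
by apply: mx_derive_mul; [exact: mx_derive_id|exact: dp].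
Qed.

Let p'_tame E : mx_tame (p' E).
Proof.
apply: mx_tameN; apply: mx_tameD; apply: mx_tame_mul => //.
  by apply: mx_tame_mul => //; exact: mx_tame_cst.
apply: mx_tame_mul; last exact: mx_tame_cst.
exact: mx_tame_tr.
Qed.

Let q'_tame E : mx_tame (q' E).
Proof.
apply: mx_tameD; first apply: mx_tameD.
- by apply: mx_tame_mul => //; exact: mx_tame_cst.
- apply: mx_tameN; apply: mx_tame_mul => //.
  by apply: mx_tame_mul => //; exact: mx_tame_cst.
- apply: mx_tameN; apply: mx_tame_mul => //.
  by apply: mx_tame_mul => //; exact: mx_tame_cst.
Qed.

Let delta_entry k l (X : 'M[R]_(k, m)) (Y : 'M[R]_(n, l)) i a x y :
  (X *m delta_mx i a *m Y) x y = X x i * Y a y.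
Proof.
rewrite mxE (bigD1 a)//= big1 ?addr0 => [|b ba].
  rewrite mxE (bigD1 i)//= big1 ?addr0 => [|c ci].
    by rewrite mxE !eqxx mulr1.
  by rewrite mxE (negbTE ci) mulr0.
rewrite mxE big1 ?mul0r// => c _; rewrite mxE (negbTE ba) andbF mulr0//.
Qed.

Let delta_entry1 l (Y : 'M[R]_(n, l)) i a x y :
  ((delta_mx i a : 'M[R]_(m, n)) *m Y) x y = (x == i)%:R * Y a y.
Proof.
rewrite -[delta_mx i a]mul1mx delta_entry mxE; congr (_%:R * _).
Qed.

Let delta_entryT k l (X : 'M[R]_(k, n)) (Y : 'M[R]_(m, l)) i a x y :
  (X *m (delta_mx i a)^T *m Y) x y = X x a * Y i y.
Proof.
rewrite trmx_delta mxE (bigD1 i)//= big1 ?addr0 => [|b ba].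
  rewrite mxE (bigD1 a)//= big1 ?addr0 => [|c ci].
    by rewrite mxE !eqxx mulr1.
  by rewrite mxE (negbTE ci) mulr0.
rewrite mxE big1 ?mul0r// => c _; rewrite mxE (negbTE ba) andbF mulr0//.
Qed.

Let q'_entry i a M x y : q' (delta_mx i a) M x y =
  (x == i)%:R * p M a y - q M x a * q M i y - r M x i * p M a y.
Proof.
rewrite /q' mxE [X in X + _]mxE [X in _ + X + _]mxE [X in _ + _ + X]mxE.
by rewrite delta_entry1 delta_entryT delta_entry.
Qed.

Let p'_entry i a M x y : p' (delta_mx i a) M x y =
  - (p M x a * q M i y + q M i x * p M a y).
Proof.
rewrite /p' mxE; congr (- _); rewrite mxE delta_entry delta_entryT.
by rewrite [(q M)^T x i]mxE.
Qed.

Let divq M : 'M[R]_n := m%:R *: p M - (q M)^T *m q M - \tr (r M) *: p M.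

Let divqE M a b : divq M a b = \sum_i q' (delta_mx i a) M i b.
Proof.
under eq_bigr do rewrite q'_entry eqxx mul1r.
rewrite !big_split /= sumr_const card_ord !sumrN -mulr_suml -/(\tr (r M)).
rewrite /divq mxE [X in X + _]mxE [X in _ + X + _]mxE [X in _ + _ + X]mxE.
rewrite [X in X - _ - _]mxE mulr_natl [X in _ - X - _]mxE [X in _ - _ - X]mxE.
by congr (_ - _ - _); apply: eq_bigr => i _; rewrite mxE.
Qed.


Let divq_simpl M : divq M =
  (m%:R - d%:R - 1) *: p M + e *: (p M *m p M) + (e * t M) *: p M.
Proof.
rewrite /divq qTq tr_r; apply/matrixP => a b; rewrite !mxE -/(t M); ring.
Qed.

Let projp M : orth_proj A *m p M = p M.
Proof. exact: orth_proj_ridge_proj. Qed.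

Let proj_gram M : orth_proj A *m (M^T *m q M) = orth_proj A - e *: p M.
Proof. exact: orth_proj_gram_ridge_proj. Qed.

(** The identity for [F = S P], multiplied on the left by the projection, which
    turns [S^T S P] into [orth_proj A - e P]. *)
Lemma ridge_proj_moment1 c b :
  \int[P]_w (orth_proj A - e *: p (mxval S w)) c b =
  m%:R^-1 * \int[P]_w ((m%:R - d%:R - 1) *: p (mxval S w) +
    e *: (p (mxval S w) *m p (mxval S w)) +
    (e * \tr (p (mxval S w))) *: p (mxval S w)) c b.
Proof.
have := matrix_stein m_gt0 S_gauss (orth_proj A) q_tame
  (fun i a => q'_tame (delta_mx i a)) (fun i a => dq (delta_mx i a)) divqE c b.
under eq_Rintegral do rewrite proj_gram.
move=> ->; congr (_ * _); apply: eq_Rintegral => w _; congr fun_of_matrix.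
by rewrite divq_simpl !mulmxDr -!scalemxAr mulmxA !projp.
Qed.

Let div2 M : 'M[R]_n :=
  divq M *m p M - ((q M *m p M)^T *m q M + \tr (q M *m (q M)^T) *: p M).

Let div2E M a b : div2 M a b =
  \sum_i (q' (delta_mx i a) M *m p M + q M *m p' (delta_mx i a) M) i b.
Proof.
under eq_bigr do rewrite mxE.
rewrite big_split /= /div2 mxE; congr (_ + _).
  rewrite mxE; under [RHS]eq_bigr do rewrite mxE.
  rewrite exchange_big /=; apply: eq_bigr => y _.
  by rewrite divqE mulr_suml.
rewrite mxE mxE [X in - (_ + X)]mxE [X in - (X + _)]mxE /mxtrace mulr_suml.
rewrite -big_split /= -sumrN.
apply: eq_bigr => i _.
rewrite [(_^T) a i]mxE [(q M *m p M) i a]mxE [(q M *m (q M)^T) i i]mxE.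
rewrite !mulr_suml -big_split /= -sumrN [RHS]mxE; apply: eq_bigr => y _.
by rewrite p'_entry [(q M)^T y i]mxE; ring.
Qed.

Let qpTq M : (q M *m p M)^T *m q M = p M *m p M - e *: (p M *m p M *m p M).
Proof.
by rewrite trmx_mul p_sym -(mulmxA (p M) (q M)^T (q M)) qTq mulmxBr -scalemxAr mulmxA.
Qed.

(** The identity for [F = S P^2]. *)
Lemma ridge_proj_moment2 c b :
  \int[P]_w (p (mxval S w) - e *: (p (mxval S w) *m p (mxval S w))) c b =
  m%:R^-1 * \int[P]_w (
    (m%:R - d%:R - 2) *: (p (mxval S w) *m p (mxval S w)) -
    \tr (p (mxval S w)) *: p (mxval S w) +
    e *: (2 *: (p (mxval S w) *m p (mxval S w) *m p (mxval S w)) +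
          \tr (p (mxval S w)) *: (p (mxval S w) *m p (mxval S w)) +
          \tr (p (mxval S w) *m p (mxval S w)) *: p (mxval S w))) c b.
Proof.
have dF i a : mx_derive (delta_mx i a) (fun M => q M *m p M)
    (fun M => q' (delta_mx i a) M *m p M + q M *m p' (delta_mx i a) M).
  by apply: mx_derive_mul; [exact: dq|exact: dp].
have tF' i a : mx_tame
    (fun M => q' (delta_mx i a) M *m p M + q M *m p' (delta_mx i a) M).
  apply: mx_tameD; first by apply: mx_tame_mul => //; exact: q'_tame.
  by apply: mx_tame_mul => //; exact: p'_tame.
have := matrix_stein m_gt0 S_gauss (orth_proj A) (mx_tame_mul q_tame p_tame)
  tF' dF div2E c b.
under eq_Rintegral do
  rewrite [X in orth_proj A *m X]mulmxA mulmxA proj_gram mulmxBl projp -scalemxAl.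
move=> ->; congr (_ * _); apply: eq_Rintegral => w _; congr fun_of_matrix.
set M := mxval S w.
have trq : \tr (q M *m (q M)^T) = t M - e * \tr (p M *m p M).
  by rewrite mxtrace_mulC qTq raddfB /= mxtraceZ.
have -> : div2 M = (m%:R - d%:R - 2) *: (p M *m p M) - \tr (p M) *: p M +
    e *: (2 *: (p M *m p M *m p M) + \tr (p M) *: (p M *m p M) +
          \tr (p M *m p M) *: p M).
  rewrite /div2 divq_simpl qpTq trq !mulmxDl -!scalemxAl /t.
  by apply/matrixP => x y; rewrite !mxE; ring.
rewrite !(mulmxDr, mulmxN) -!scalemxAr !(mulmxDr, mulmxN) -!scalemxAr !mulmxA.
by rewrite !projp.
Qed.

Let div3 M : 'M[R]_n := t M *: divq M - 2 *: ((q M *m p M)^T *m q M).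

Let div3E M a b : div3 M a b =
  \sum_i (\tr (p' (delta_mx i a) M) *: q M + t M *: q' (delta_mx i a) M) i b.
Proof.
have tr_p' i : \tr (p' (delta_mx i a) M) = - (2 * (q M *m p M) i a).
  rewrite mxE mulr_sumr /mxtrace -sumrN; apply: eq_bigr => y _.
  have s : p M a y = p M y a by rewrite -{1}(p_sym M) mxE.
  by rewrite p'_entry s; ring.
under eq_bigr do rewrite mxE tr_p' [X in X + _]mxE [X in _ + X]mxE.
rewrite big_split /= -mulr_sumr -divqE /div3 mxE addrC.
rewrite [X in _ + X]mxE; congr (_ + _).
rewrite 3!mxE mulr_sumr -sumrN; apply: eq_bigr => i _.
by rewrite [(_^T) a i]mxE; ring.
Qed.

(** The identity for [F = tr(P) S P]. *)
Lemma ridge_proj_moment3 c b :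
  \int[P]_w (\tr (p (mxval S w)) *: (orth_proj A - e *: p (mxval S w))) c b =
  m%:R^-1 * \int[P]_w (
    ((m%:R - d%:R - 1) * \tr (p (mxval S w))) *: p (mxval S w) -
    2 *: (p (mxval S w) *m p (mxval S w)) +
    e *: (\tr (p (mxval S w)) *: (p (mxval S w) *m p (mxval S w)) +
          \tr (p (mxval S w)) ^+ 2 *: p (mxval S w) +
          2 *: (p (mxval S w) *m p (mxval S w) *m p (mxval S w)))) c b.
Proof.
have dF i a : mx_derive (delta_mx i a) (fun M => t M *: q M)
    (fun M => \tr (p' (delta_mx i a) M) *: q M + t M *: q' (delta_mx i a) M).
  by apply: mx_deriveZ; [exact/dir_derive_mxtrace/dp|exact: dq].
have tF' i a : mx_tame
    (fun M => \tr (p' (delta_mx i a) M) *: q M + t M *: q' (delta_mx i a) M).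
  apply: mx_tameD; last by apply: mx_tameZ => //; exact: q'_tame.
  by apply: mx_tameZ => //; exact/tame_mxtrace/p'_tame.
have := matrix_stein m_gt0 S_gauss (orth_proj A) (mx_tameZ t_tame q_tame)
  tF' dF div3E c b.
under eq_Rintegral do rewrite -!scalemxAr proj_gram.
move=> ->; congr (_ * _); apply: eq_Rintegral => w _; congr fun_of_matrix.
set M := mxval S w.
have -> : div3 M = ((m%:R - d%:R - 1) * \tr (p M)) *: p M - 2 *: (p M *m p M) +
    e *: (\tr (p M) *: (p M *m p M) + \tr (p M) ^+ 2 *: p M +
          2 *: (p M *m p M *m p M)).
  rewrite /div3 divq_simpl qpTq /t.
  by apply/matrixP => x y; rewrite !mxE; ring.
rewrite !(mulmxDr, mulmxN) -!scalemxAr !(mulmxDr, mulmxN) -!scalemxAr !mulmxA.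
by rewrite !projp.
Qed.

End RidgeMoments.

(** * Uniform bounds *)

Section UniformBounds.
Variables (disp : measure_display) (T : measurableType disp) (R : realType).
Variables (P : probability T R) (m n d : nat) (S : randmx P m n).
Hypothesis m_gt : (d + 3 < m)%N.
Hypothesis S_gauss : gaussian_sketch S.
Variables (A : 'M[R]_(n, d)).
Hypothesis A_full : \rank A = d.

Let m_gt0 : (0 < m)%N. Proof. by case: m m_gt. Qed.

Lemma codim_ge4 : 4 <= m%:R - d%:R :> R.
Proof. by rewrite lerBrDl -natrD ler_nat addnS. Qed.

Let Ex (f : 'M[R]_(m, n) -> R) := \int[P]_w f (mxval S w).

Let ExD f g : tame f -> tame g -> Ex (fun M => f M + g M) = Ex f + Ex g.
Proof. by move=> tf tg; apply: RintegralD => //; exact: integrable_tame. Qed.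

Let ExB f g : tame f -> tame g -> Ex (fun M => f M - g M) = Ex f - Ex g.
Proof. by move=> tf tg; apply: RintegralB => //; exact: integrable_tame. Qed.

Let ExZ c f : tame f -> Ex (fun M => c * f M) = c * Ex f.
Proof. by move=> tf; apply: RintegralZl => //; exact: integrable_tame. Qed.

Let ExC c : Ex (fun=> c) = c.
Proof. by rewrite /Ex Rintegral_cst// [X in fine X](probability_setT P) mulr1. Qed.

Let Ex_le f g : tame f -> tame g -> (forall M, f M <= g M) -> Ex f <= Ex g.
Proof.
by move=> tf tg fg; apply: le_Rintegral => //; exact: integrable_tame.
Qed.

Let Ex_mxtrace c (F G : 'M[R]_(m, n) -> 'M[R]_n) : mx_tame F -> mx_tame G ->
  (forall a b, Ex (fun M => F M a b) = c * Ex (fun M => G M a b)) ->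
  Ex (fun M => \tr (F M)) = c * Ex (fun M => \tr (G M)).
Proof.
move=> tF tG FG; rewrite /Ex /mxtrace !Rintegral_sum => [|i|i].
- by rewrite mulr_sumr; apply: eq_bigr => i _; exact: FG.
- exact: (integrable_tame S (tG i i)).
- exact: (integrable_tame S (tF i i)).
Qed.

Section FixedRegularization.
Variables (e : R).
Hypothesis e_gt0 : 0 < e.

Let p (M : 'M[R]_(m, n)) := ridge_proj A e M.
Let t (M : 'M[R]_(m, n)) := \tr (p M).
Let s (M : 'M[R]_(m, n)) := \tr (p M *m p M).
Let r3 (M : 'M[R]_(m, n)) := \tr (p M *m p M *m p M).

Let p_tame : mx_tame p. Proof. exact: ridge_proj_tame. Qed.
Let pp_tame : mx_tame (fun M => p M *m p M). Proof. exact: mx_tame_mul. Qed.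
Let ppp_tame : mx_tame (fun M => p M *m p M *m p M). Proof. exact: mx_tame_mul. Qed.
Let t_tame : tame t. Proof. exact: tame_mxtrace. Qed.
Let s_tame : tame s. Proof. exact: tame_mxtrace. Qed.
Let tt_tame : tame (fun M => t M ^+ 2).
Proof. by rewrite (_ : (fun M => _) = (fun M => t M * t M)); [exact: tameM|]. Qed.

Let p_psd M : psd (p M).
Proof. by apply: ridge_proj_psd; [exact: ltW|exact: ridge_gram_unit]. Qed.

Let p_sym M : (p M)^T = p M. Proof. exact: ridge_proj_sym. Qed.
Let t_ge0 M : 0 <= t M. Proof. exact: psd_tr_ge0. Qed.
Let s_ge0 M : 0 <= s M.
Proof. by rewrite /s -{1}(p_sym M); exact: tr_gram_ge0. Qed.
Let r3_ge0 M : 0 <= r3 M.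
Proof. by rewrite /r3 -{3}(p_sym M); exact/psd_tr_ge0/psd_congr. Qed.

Let k : R := m%:R - d%:R.
Let k4 : 4 <= k. Proof. exact: codim_ge4. Qed.
Let mV : 0 < m%:R^-1 :> R. Proof. by rewrite invr_gt0 ltr0n. Qed.

(** The trace of the first identity, without the nonnegative terms that have a
    factor [e]. *)
Lemma mean_tr_ridge_proj_le :
  m%:R^-1 * (k - 1) * \int[P]_w \tr (ridge_proj A e (mxval S w)) <= d%:R.
Proof.
pose F M := orth_proj A - e *: p M.
pose G M := (k - 1) *: p M + e *: (p M *m p M) + (e * t M) *: p M.
have tF : mx_tame F.
  apply: mx_tameD; first exact: mx_tame_cst.
  by apply: mx_tameN; apply: mx_tameZ => //; exact: tame_cst.
have tG : mx_tame G.
  apply: mx_tameD; last by apply: mx_tameZ => //; apply: tameM => //; exact: tame_cst.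
  by apply: mx_tameD; apply: mx_tameZ => //; exact: tame_cst.
have E1 := Ex_mxtrace tF tG (ridge_proj_moment1 m_gt0 S_gauss A_full e_gt0).
have trG : tame (fun M => m%:R^-1 * \tr (G M)) by apply/tameZ/tame_mxtrace.
have trF : tame (fun M => \tr (F M)) by exact: tame_mxtrace.
have h : Ex (fun M => \tr (F M) - m%:R^-1 * \tr (G M)) <=
         Ex (fun M => d%:R - m%:R^-1 * (k - 1) * t M).
  apply: Ex_le => [||M].
  - by apply: tameD => //; exact: tameN.
  - by apply: tameD; [exact: tame_cst|apply: tameN; exact: tameZ].
  rewrite /F /G raddfB /= tr_orth_proj// !raddfD /= !mxtraceZ -/(t M) -/(s M).
  rewrite -subr_ge0 [leRHS](_ : _ = e * (t M + m%:R^-1 * (s M + t M ^+ 2))); last by ring.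
  by rewrite mulr_ge0 ?(ltW e_gt0)// addr_ge0// mulr_ge0 ?(ltW mV)// addr_ge0 ?sqr_ge0.
move: h; rewrite (ExB trF trG) ExZ; last exact: tame_mxtrace.
rewrite E1 subrr ExB; [|exact: tame_cst|exact: tameZ].
by rewrite ExC ExZ// subr_ge0.
Qed.

(** Adding twice the trace of the second identity to [k - 2] times the trace of
    the third one eliminates the mean of [tr (P^2)] and leaves
    [(k - 1) (k - 2) - 2 = k (k - 3)] times the mean of [(tr P)^2], up to
    nonnegative terms with a factor [e]. *)
Lemma mean_sqr_tr_ridge_proj_le :
  m%:R^-1 * (k * (k - 3)) * \int[P]_w \tr (ridge_proj A e (mxval S w)) ^+ 2 <=
  (2 + (k - 2) * d%:R) * \int[P]_w \tr (ridge_proj A e (mxval S w)).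
Proof.
pose F2 M := p M - e *: (p M *m p M).
pose G2 M := (k - 2) *: (p M *m p M) - t M *: p M +
  e *: (2 *: (p M *m p M *m p M) + t M *: (p M *m p M) + s M *: p M).
pose F3 M := t M *: (orth_proj A - e *: p M).
pose G3 M := ((k - 1) * t M) *: p M - 2 *: (p M *m p M) +
  e *: (t M *: (p M *m p M) + t M ^+ 2 *: p M + 2 *: (p M *m p M *m p M)).
have tZ (c : R) (X : 'M[R]_(m, n) -> 'M[R]_n) : mx_tame X -> mx_tame (fun M => c *: X M).
  by move=> tX; apply: mx_tameZ => //; exact: tame_cst.
have tF2 : mx_tame F2 by apply: mx_tameD => //; apply: mx_tameN; exact: tZ.
have tF3 : mx_tame F3.
  apply: mx_tameZ => //; apply: mx_tameD; first exact: mx_tame_cst.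
  by apply: mx_tameN; exact: tZ.
have tG2 : mx_tame G2.
  apply: mx_tameD; first by apply: mx_tameD; [exact: tZ|apply: mx_tameN; exact: mx_tameZ].
  apply: (tZ); apply: mx_tameD; last exact: mx_tameZ.
  by apply: mx_tameD; [exact: tZ|exact: mx_tameZ].
have tG3 : mx_tame G3.
  apply: mx_tameD.
    by apply: mx_tameD; [apply: mx_tameZ => //; exact: tameZ|apply: mx_tameN; exact: tZ].
  apply: (tZ); apply: mx_tameD; last exact: tZ.
  by apply: mx_tameD; exact: mx_tameZ.
have E2 := Ex_mxtrace tF2 tG2 (ridge_proj_moment2 m_gt0 S_gauss A_full e_gt0).
have E3 := Ex_mxtrace tF3 tG3 (ridge_proj_moment3 m_gt0 S_gauss A_full e_gt0).
have c2F2 : tame (fun M => 2 * \tr (F2 M)) by apply/tameZ/tame_mxtrace.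
have c2G2 : tame (fun M => 2 * \tr (G2 M)) by apply/tameZ/tame_mxtrace.
have ckF3 : tame (fun M => (k - 2) * \tr (F3 M)) by apply/tameZ/tame_mxtrace.
have ckG3 : tame (fun M => (k - 2) * \tr (G3 M)) by apply/tameZ/tame_mxtrace.
have sF : tame (fun M => 2 * \tr (F2 M) + (k - 2) * \tr (F3 M)) by exact: tameD.
have sG : tame (fun M => 2 * \tr (G2 M) + (k - 2) * \tr (G3 M)) by exact: tameD.
have h : Ex (fun M => (2 * \tr (F2 M) + (k - 2) * \tr (F3 M)) -
      m%:R^-1 * (2 * \tr (G2 M) + (k - 2) * \tr (G3 M))) <=
    Ex (fun M => (2 + (k - 2) * d%:R) * t M - m%:R^-1 * (k * (k - 3)) * t M ^+ 2).
  apply: Ex_le => [||M].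
  - by apply: tameD => //; apply: tameN; exact: tameZ.
  - by apply: tameD; [exact: tameZ|apply: tameN; exact: tameZ].
  rewrite /F2 /F3 /G2 /G3 mxtraceZ !raddfB /= tr_orth_proj// !raddfD /=.
  rewrite !(raddfN, raddfD, mxtraceZ) /= !mxtraceZ -/(t M) -/(s M) -/(r3 M).
  rewrite -subr_ge0 [leRHS](_ : _ = e * (2 * s M + (k - 2) * t M ^+ 2 + m%:R^-1 *
    (4 * r3 M + 4 * (t M * s M) + (k - 2) * (t M * s M + t M ^+ 3 + 2 * r3 M)))); last by ring.
  have k2 : 0 <= k - 2 by have := k4; lra.
  move: (k - 2) k2 => c c0.
  by rewrite mulr_ge0 ?(ltW e_gt0)// !(addr_ge0, mulr_ge0, exprn_ge0)// ltW.
move: h; rewrite (ExB sF (tameZ _ sG)) (ExZ _ sG) (ExD c2F2 ckF3) (ExD c2G2 ckG3).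
rewrite !ExZ; try exact: tame_mxtrace.
rewrite E2 E3 [leLHS](_ : _ = 0); last by ring.
by rewrite ExB; [|exact: tameZ|exact: tameZ]; rewrite !ExZ// subr_ge0.
Qed.

End FixedRegularization.
End UniformBounds.

(** * Removing the regularization *)

Section Limit.
Variables (disp : measure_display) (T : measurableType disp) (R : realType).
Variables (P : probability T R) (m n d : nat) (S : randmx P m n).
Hypothesis m_gt : (d + 3 < m)%N.
Hypothesis S_gauss : gaussian_sketch S.
Variables (A : 'M[R]_(n, d)).
Hypothesis A_full : \rank A = d.

Let m_gt0 : (0 < m)%N. Proof. by case: m m_gt. Qed.
Let k : R := m%:R - d%:R.
Let k4 : 4 <= k. Proof. exact: codim_ge4. Qed.
Let mV : 0 < m%:R^-1 :> R. Proof. by rewrite invr_gt0 ltr0n. Qed.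

Let eps (N : nat) : R := N.+1%:R^-1.
Let eps_gt0 N : 0 < eps N. Proof. by rewrite invr_gt0 ltr0n. Qed.

Let M w := mxval S w.
Let p N w := ridge_proj A (eps N) (M w).
Let p0 w := ridge_proj A 0 (M w).
Let t N w := \tr (p N w).
Let t0 w := \tr (p0 w).

(** The Gram matrix of [S A] is invertible exactly when [S A] is injective. *)
Definition sketch_injective w := ridge_gram A 0 (mxval S w) \in unitmx.
Let reg := sketch_injective.

Let u N w : ridge_gram A (eps N) (M w) \in unitmx.
Proof. exact: ridge_gram_unit. Qed.

Let p_psd N w : psd (p N w).
Proof. by apply: ridge_proj_psd => //; exact: ltW. Qed.

Let t_ge0 N w : 0 <= t N w. Proof. exact: psd_tr_ge0. Qed.

Let t_le N w : reg w -> t N w <= t0 w.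
Proof. by move=> rw; apply: tr_ridge_proj_mono => //; exact: ltW. Qed.

Let t_nd w N N' : (N <= N')%N -> t N w <= t N' w.
Proof.
move=> NN; apply: tr_ridge_proj_mono => //; first exact: ltW.
by rewrite lef_pV2 ?posrE// ler_nat ltnS.
Qed.

Let p_le N w a b : `|p N w a b| <= t N w.
Proof. exact: psd_entry_le_tr. Qed.

Let mM : mx_measurable M. Proof. by move=> i j; exact: measurable_mxval. Qed.
Let mp N : mx_measurable (p N). Proof. exact: mx_measurable_ridge_proj. Qed.
Let mp0 : mx_measurable p0. Proof. exact: mx_measurable_ridge_proj. Qed.
Let mt N : measurable_fun setT (t N).
Proof. by apply: measurable_sum => i; exact: mp. Qed.
Let mt0 : measurable_fun setT t0.
Proof. by apply: measurable_sum => i; exact: mp0. Qed.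

Let eps_cvg : eps N @[N --> \oo] --> (0 : R).
Proof. exact: cvg_harmonic. Qed.

Let p_cvg w : reg w -> mx_cvg \oo (p ^~ w) (p0 w).
Proof.
move=> rw a b.
have E N : p N w a b = p0 w a b + \sum_c p N w a c * - (eps N * p0 w c b).
  have := ridge_proj_resolvent (u N w) rw.
  rewrite raddf0 addr0 opprD addrA subrr sub0r mulmxN mulNmx mul_mx_scalar.
  rewrite -scalemxAl -[M w]/(mxval S w) -/(p N w) -/(p0 w) => /matrixP /(_ a b).
  rewrite [LHS]mxE [X in _ + X]mxE => /eqP; rewrite subr_eq addrC => /eqP ->.
  rewrite [X in _ + X = _]mxE [X in _ - X = _]mxE mxE mulr_sumr -sumrN.
  by congr (_ + _); apply: eq_bigr => c _; rewrite mulrN mulrCA.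
rewrite (_ : (fun N => _) = (fun N =>
  p0 w a b + \sum_c p N w a c * - (eps N * p0 w c b))); last exact/funext.
rewrite -[X in _ --> X]addr0; apply: cvgD; first exact: cvg_cst.
have s0 : \sum_(c < n) (0 : R) = 0 by rewrite big1.
rewrite -[X in _ --> X]s0; apply: cvg_big => [|c _]; first exact: add_continuous.
apply: (@cvg0_bounded_mul _ _ _ _ _ _ (t0 w)).
  by move=> N; rewrite (le_trans (p_le _ _ _ _))// t_le.
rewrite -[X in _ --> X]oppr0 -[X in _ --> - X](mul0r (p0 w c b)).
by apply: cvgN; apply: cvgM; [exact: eps_cvg|exact: cvg_cst].
Qed.

Let t_cvg w : reg w -> t N w @[N --> \oo] --> t0 w.
Proof. by move=> rw; apply: cvg_mxtrace; exact: p_cvg. Qed.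

(** Squares, rather than the traces themselves, go to the limit: their limit is
    what dominates the quadratic terms later on. *)
Let g N w : \bar R := ((t N w) ^+ 2)%:E.

Let g_ge0 N w : (0 <= g N w)%E.
Proof. by rewrite lee_fin sqr_ge0. Qed.

Let mg N : measurable_fun setT (g N).
Proof. by apply/measurable_EFinP; apply: measurable_funX. Qed.

Let g_nd w : nondecreasing_seq (g ^~ w).
Proof. by move=> N N' NN; rewrite lee_fin ler_sqr ?nnegrE// t_nd. Qed.

Let h w := limn (g ^~ w).

Let g_le_h N w : (g N w <= h w)%E.
Proof.
rewrite /h (cvg_lim _ (ereal_nondecreasing_cvgn (g_nd w)))//.
by apply: ereal_sup_ubound; exists N.
Qed.

Let int_g_bounded : exists C : R, forall N, (\int[P]_w g N w <= C%:E)%E.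
Proof.
pose C1 := d%:R / (m%:R^-1 * (k - 1)).
exists ((2 + (k - 2) * d%:R) * C1 / (m%:R^-1 * (k * (k - 3)))) => N.
have k1 : 0 < m%:R^-1 * (k - 1) by rewrite mulr_gt0//; have := k4; lra.
have k3 : 0 < m%:R^-1 * (k * (k - 3)).
  by rewrite mulr_gt0// mulr_gt0//; have := k4; lra.
have tT : tame (fun X : 'M[R]_(m, n) => \tr (ridge_proj A (eps N) X)).
  by apply: tame_mxtrace; exact: ridge_proj_tame.
have Ig : P.-integrable setT (g N).
  by have := integrable_tame S (tameM tT tT).
have -> : (\int[P]_w g N w = (\int[P]_w (t N w ^+ 2))%:E)%E.
  by rewrite /Rintegral fineK//; exact: integrable_fin_num.
rewrite lee_fin ler_pdivlMr// mulrC.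
apply: (le_trans (mean_sqr_tr_ridge_proj_le m_gt S_gauss A_full (eps_gt0 N))).
apply: ler_wpM2l.
  by rewrite addr_ge0// mulr_ge0//; have := k4; rewrite /k; lra.
rewrite ler_pdivlMr// mulrC.
exact: (mean_tr_ridge_proj_le m_gt S_gauss A_full (eps_gt0 N)).
Qed.

Let Ih : P.-integrable setT h.
Proof.
apply/integrableP; split.
  apply: (emeasurable_fun_cvg g) => // w _; exact: ereal_nondecreasing_is_cvgn.
have [C gC] := int_g_bounded.
rewrite (eq_integral h); last first.
  by move=> w _; rewrite gee0_abs// (le_trans (g_ge0 0 w)).
rewrite (@monotone_convergence _ _ _ P _ measurableT g)//.
apply: (@le_lt_trans _ _ C%:E); last exact: ltry.
apply: lime_le; last by apply: nearW => N; exact: gC.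
apply: ereal_nondecreasing_is_cvgn => N N' NN; apply: ge0_le_integral => //.
by move=> w _; exact: g_nd.
Qed.

(** On the singular event the regularized traces grow like [1 / eps], hence the
    uniform bound makes this event negligible. *)
Lemma ae_sketch_injective : {ae P, forall w, sketch_injective w}.
Proof.
have := integrable_ae measurableT Ih; apply: filterS => w /(_ I) hfin.
apply: contrapT => /negP nreg.
have [c c0 ct] := singular_tr_ridge_proj A_full nreg.
have cN N : c * N.+1%:R <= t N w.
  by have := ct _ (eps_gt0 N); rewrite mulrC ler_pdivlMr.
have [N Nr] : exists N : nat, fine (h w) < c ^+ 2 * N.+1%:R.
  have : \forall N \near \oo, fine (h w) / c ^+ 2 < N%:R by exact: nbhs_infty_gtr.
  move=> [N _ /(_ N (leqnn N))] /=.
  rewrite ltr_pdivrMr ?exprn_gt0// => lt; exists N; apply: (lt_le_trans lt).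
  by rewrite mulrC ler_wpM2l ?sqr_ge0// ler_nat.
have : t N w ^+ 2 <= fine (h w) by rewrite -lee_fin fineK//; exact: g_le_h.
apply/negP; rewrite -ltNge; apply: (lt_le_trans Nr).
apply: (@le_trans _ _ ((c * N.+1%:R) ^+ 2)).
  by rewrite exprMn ler_wpM2l ?sqr_ge0// -natrX ler_nat expnS expn1 leq_pmulr.
by rewrite ler_sqr ?nnegrE ?mulr_ge0// ltW.
Qed.

Let It02 : P.-integrable setT (fun w => (t0 w ^+ 2)%:E).
Proof.
have mt02 : measurable_fun setT (fun w => (t0 w ^+ 2)%:E).
  by apply/measurable_EFinP; exact: measurable_funX.
have mh : measurable_fun setT h by exact: measurable_int Ih.
have E : ae_eq P setT h (fun w => (t0 w ^+ 2)%:E).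
  apply: filterS ae_sketch_injective => w rw _; apply: cvg_lim => //.
  apply: cvg_EFin; first exact: nearW.
  exact: (cvgM (t_cvg rw) (t_cvg rw)).
apply/integrableP; split=> //; have /integrableP[_] := Ih.
congr (_ < _)%E; apply: ae_eq_integral => //; try exact: measurableT_comp.
exact: ae_eq_abse.
Qed.

(** The limits under the integral sign below are all instances of dominated
    convergence, with a dominating function of the form [K * (1 + t0 ^ 2)]. *)
Let dominated (f : nat -> T -> R) (f0 : T -> R) := [/\ forall N, measurable_fun setT (f N),
  measurable_fun setT f0, forall w, reg w -> f N w @[N --> \oo] --> f0 w &
  exists K, forall N w, reg w -> `|f N w| <= K * (1 + t0 w ^+ 2)].

Let dominated_cst c : dominated (fun _ _ => c) (fun=> c).
Proof.
split=> [N||w _|]; [exact: measurable_cst|exact: measurable_cst|exact: cvg_cst|].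
by exists `|c| => N w _; rewrite ler_peMr// lerDl sqr_ge0.
Qed.

Let dominatedD f f0 f' f0' : dominated f f0 -> dominated f' f0' ->
  dominated (fun N w => f N w + f' N w) (fun w => f0 w + f0' w).
Proof.
move=> [mf mf0 cf [K fK]] [mg' mg0 cg [L gL]]; split=> [N||w rw|].
- exact: measurable_funD.
- exact: measurable_funD.
- by apply: cvgD; [exact: cf|exact: cg].
- exists (K + L) => N w rw; rewrite (le_trans (ler_normD _ _))// mulrDl lerD//.
    exact: fK.
  exact: gL.
Qed.

Let dominatedZ c f f0 : dominated f f0 -> dominated (fun N w => c * f N w) (fun w => c * f0 w).
Proof.
move=> [mf mf0 cf [K fK]]; split=> [N||w rw|].
- by apply: measurable_funM => //; exact: measurable_cst.
- by apply: measurable_funM => //; exact: measurable_cst.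
- by apply: cvgM; [exact: cvg_cst|exact: cf].
- by exists (`|c| * K) => N w rw; rewrite normrM -mulrA ler_wpM2l// fK.
Qed.

Let dominated_plain (f : nat -> T -> R) (f0 : T -> R) K :
  (forall N, measurable_fun setT (f N)) ->
  measurable_fun setT f0 -> (forall w, reg w -> f N w @[N --> \oo] --> f0 w) ->
  0 <= K -> (forall N w, `|f N w| <= K * (1 + t N w ^+ 2)) -> dominated f f0.
Proof.
move=> mf mf0 cf K0 fK; split=> //; exists K => N w rw.
rewrite (le_trans (fK _ _))// ler_wpM2l// lerD2l ler_sqr ?nnegrE ?t_le//.
exact: le_trans (t_ge0 N w) (t_le _ rw).
Qed.

Let eps_t_le N w : eps N * t N w <= d%:R.
Proof. by apply: tr_ridge_proj_le => //; exact: ltW. Qed.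

(** As [eps * t <= d], the regularization parameter absorbs one power of the
    trace; so the cubic terms with a factor [eps] are dominated, too. *)
Let dominated_eps (f : nat -> T -> R) (f0 : T -> R) K :
  (forall N, measurable_fun setT (f N)) ->
  (forall w, reg w -> f N w @[N --> \oo] --> f0 w) ->
  0 <= K -> (forall N w, `|f N w| <= K * (t N w + t N w ^+ 3)) ->
  dominated (fun N w => eps N * f N w) (fun=> 0).
Proof.
move=> mf cf K0 fK; apply: (@dominated_plain _ _ (K * d%:R)).
- by move=> N; apply: measurable_funM => //; exact: measurable_cst.
- exact: measurable_cst.
- move=> w rw; rewrite -[X in _ --> X](mul0r (f0 w)).
  by apply: cvgM; [exact: eps_cvg|exact: cf].
- by rewrite mulr_ge0.
- move=> N w; rewrite normrM (gtr0_norm (eps_gt0 N)).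
  apply: (@le_trans _ _ (eps N * (K * (t N w + t N w ^+ 3)))).
    by rewrite ler_wpM2l ?(ltW (eps_gt0 N)).
  rewrite (_ : _ * (K * _) = K * (eps N * t N w) * (1 + t N w ^+ 2)); last by ring.
  by rewrite ler_wpM2r ?addr_ge0 ?sqr_ge0// ler_wpM2l.
Qed.

Let dominated_cvg f f0 : dominated f f0 -> P.-integrable setT (EFin \o f0) /\
  \int[P]_w f N w @[N --> \oo] --> \int[P]_w f0 w.
Proof.
move=> [mf mf0 cf [K fK]].
have Idom : P.-integrable setT (fun w => (K * (1 + t0 w ^+ 2))%:E).
  apply: (@integrable_RZ _ _ _ _ K (fun w => 1 + t0 w ^+ 2)).
  have := integrableD measurableT
    (@finite_measure_integrable_cst _ _ _ P setT 1 measurableT) It02.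
  by apply: eq_integrable.
have [] := @dominated_convergence _ _ _ P setT measurableT
  (fun N => EFin \o f N) (EFin \o f0) (fun w => (K * (1 + t0 w ^+ 2))%:E) => //.
- by move=> N; exact/measurable_EFinP.
- exact/measurable_EFinP.
- apply: filterS ae_sketch_injective => w rw _.
  by apply: cvg_EFin; [exact: nearW|exact: cf].
- by apply: filterS ae_sketch_injective => w rw N _; rewrite lee_fin fK.
move=> I0 _ C; split=> //; apply: fine_cvg; rewrite fineK//.
exact: integrable_fin_num.
Qed.

Let dominated_eq f f0 f' f0' c : dominated f f0 -> dominated f' f0' ->
  (forall N, \int[P]_w f N w = c * \int[P]_w f' N w) ->
  \int[P]_w f0 w = c * \int[P]_w f0' w.
Proof.
move=> /dominated_cvg[_ cf] /dominated_cvg[_ cg] fg.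
apply: (@cvg_unique R _ (\int[P]_w f N w @[N --> \oo]) _ _ _ cf) => //.
rewrite (_ : (fun N => _) = (fun N => c * \int[P]_w f' N w)); last exact/funext.
by apply: cvgM; [exact: cvg_cst|exact: cg].
Qed.

Let entry_mul_le (X Y : 'M[R]_n) (x y : R) : (forall a b, `|X a b| <= x) ->
  (forall a b, `|Y a b| <= y) -> forall a b, `|(X *m Y) a b| <= n%:R * (x * y).
Proof.
move=> Xx Yy a b; rewrite mxE (le_trans (ler_norm_sum _ _ _))//.
rewrite -[X in X%:R](card_ord n) mulr_natl -sumr_const.
by apply: ler_sum => i _; rewrite normrM ler_pM.
Qed.

Let mpp N : mx_measurable (fun w => p N w *m p N w).
Proof. exact: mx_measurable_mul. Qed.
Let mpp0 : mx_measurable (fun w => p0 w *m p0 w).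
Proof. exact: mx_measurable_mul. Qed.
Let mppp N : mx_measurable (fun w => p N w *m p N w *m p N w).
Proof. exact: mx_measurable_mul. Qed.
Let ms N : measurable_fun setT (fun w => \tr (p N w *m p N w)).
Proof. by apply: measurable_sum => i; exact: mpp. Qed.

Let pp_cvg w : reg w -> mx_cvg \oo (fun N => p N w *m p N w) (p0 w *m p0 w).
Proof. by move=> rw; apply: mx_cvg_mul; exact: p_cvg. Qed.
Let ppp_cvg w : reg w ->
  mx_cvg \oo (fun N => p N w *m p N w *m p N w) (p0 w *m p0 w *m p0 w).
Proof. by move=> rw; apply: mx_cvg_mul; [exact: pp_cvg|exact: p_cvg]. Qed.

Let pp_le N w a b : `|(p N w *m p N w) a b| <= n%:R * (t N w * t N w).
Proof. by apply: entry_mul_le => a' b'; exact: p_le. Qed.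
Let ppp_le N w a b :
  `|(p N w *m p N w *m p N w) a b| <= n%:R * (n%:R * (t N w * t N w) * t N w).
Proof. by apply: entry_mul_le => a' b'; [exact: pp_le|exact: p_le]. Qed.
Let s_le N w : `|\tr (p N w *m p N w)| <= n%:R * (n%:R * (t N w * t N w)).
Proof.
rewrite (le_trans (ler_norm_sum _ _ _))//.
rewrite -[X in _ <= X%:R * _](card_ord n) mulr_natl -sumr_const.
by apply: ler_sum => i _; exact: pp_le.
Qed.

Let n0 : 0 <= n%:R :> R. Proof. exact: ler0n. Qed.

Let dominated_p a b : dominated (fun N w => p N w a b) (fun w => p0 w a b).
Proof.
apply: (@dominated_plain _ _ 1) => [N||w rw||N w].
- exact: mp.
- exact: mp0.
- exact: p_cvg.
- exact: ler01.
by rewrite (le_trans (p_le _ _ _ _))// mul1r; have := t_ge0 N w; nra.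
Qed.

Let dominated_t : dominated t t0.
Proof.
apply: (@dominated_plain _ _ 1) => [N||w rw||N w] //; first exact: t_cvg.
by rewrite ger0_norm// mul1r; have := t_ge0 N w; nra.
Qed.

Let dominated_pp a b :
  dominated (fun N w => (p N w *m p N w) a b) (fun w => (p0 w *m p0 w) a b).
Proof.
apply: (@dominated_plain _ _ n%:R) => [N||w rw||N w].
- exact: mpp.
- exact: mpp0.
- exact: pp_cvg.
- exact: n0.
by rewrite (le_trans (pp_le _ _ _ _))// ler_wpM2l// -expr2 lerDr.
Qed.

Let dominated_tp a b : dominated (fun N w => t N w * p N w a b) (fun w => t0 w * p0 w a b).
Proof.
apply: (@dominated_plain _ _ 1) => [N||w rw||N w].
- by apply: measurable_funM => //; exact: mp.
- by apply: measurable_funM => //; exact: mp0.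
- by apply: cvgM; [exact: t_cvg|exact: p_cvg].
- exact: ler01.
- rewrite normrM (ger0_norm (t_ge0 _ _)) mul1r.
  apply: (@le_trans _ _ (t N w * t N w)); first by rewrite ler_wpM2l.
  by rewrite -expr2 lerDr.
Qed.

Let eps_p a b : dominated (fun N w => eps N * p N w a b) (fun=> 0).
Proof.
apply: (@dominated_eps _ (fun w => p0 w a b) 1) => [N|w rw||N w].
- exact: mp.
- exact: p_cvg.
- exact: ler01.
by rewrite (le_trans (p_le _ _ _ _))// mul1r lerDl exprn_ge0.
Qed.

Let sqr_le N w : t N w * t N w <= t N w + t N w ^+ 3.
Proof.
have := t_ge0 N w; have := sqr_ge0 (t N w - 1); move: (t N w) => x x1 x0.
rewrite (_ : x ^+ 3 = x * (x * x)); last by ring.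
nra.
Qed.

Let eps_pp a b : dominated (fun N w => eps N * (p N w *m p N w) a b) (fun=> 0).
Proof.
apply: (@dominated_eps _ (fun w => (p0 w *m p0 w) a b) n%:R) => [N|w rw||N w].
- exact: mpp.
- exact: pp_cvg.
- exact: n0.
by rewrite (le_trans (pp_le _ _ _ _))// ler_wpM2l.
Qed.

Let eps_tp a b : dominated (fun N w => eps N * (t N w * p N w a b)) (fun=> 0).
Proof.
have [mtp _ ctp _] := dominated_tp a b.
apply: (@dominated_eps _ _ 1 mtp ctp) => [|N w]; first exact: ler01.
rewrite normrM (ger0_norm (t_ge0 _ _)) mul1r; apply: le_trans (sqr_le N w).
by rewrite ler_wpM2l.
Qed.

Let cube_le N w : t N w * t N w * t N w <= t N w + t N w ^+ 3.
Proof. by rewrite (_ : t N w * _ * _ = t N w ^+ 3) ?lerDr//; ring. Qed.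

Let eps_ppp a b : dominated (fun N w => eps N * (p N w *m p N w *m p N w) a b) (fun=> 0).
Proof.
apply: (@dominated_eps _ (fun w => (p0 w *m p0 w *m p0 w) a b) (n%:R * n%:R)) => [N|w rw||N w].
- exact: mppp.
- exact: ppp_cvg.
- exact: mulr_ge0.
rewrite (le_trans (ppp_le _ _ _ _))// -!mulrA ler_wpM2l// ler_wpM2l// mulrA.
exact: cube_le.
Qed.

Let eps_tpp a b : dominated (fun N w => eps N * (t N w * (p N w *m p N w) a b)) (fun=> 0).
Proof.
apply: (@dominated_eps _ (fun w => t0 w * (p0 w *m p0 w) a b) n%:R) => [N|w rw||N w].
- by apply: measurable_funM => //; exact: mpp.
- by apply: cvgM; [exact: t_cvg|exact: pp_cvg].
- exact: n0.
- rewrite normrM (ger0_norm (t_ge0 _ _)).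
  apply: (@le_trans _ _ (t N w * (n%:R * (t N w * t N w)))); first by rewrite ler_wpM2l.
  by rewrite mulrCA ler_wpM2l// mulrA cube_le.
Qed.

Let eps_sp a b :
  dominated (fun N w => eps N * (\tr (p N w *m p N w) * p N w a b)) (fun=> 0).
Proof.
apply: (@dominated_eps _ (fun w => \tr (p0 w *m p0 w) * p0 w a b) (n%:R * n%:R))
  => [N|w rw||N w].
- by apply: measurable_funM; [exact: ms|exact: mp].
- by apply: cvgM; [apply: cvg_mxtrace; exact: pp_cvg|exact: p_cvg].
- exact: mulr_ge0.
- rewrite normrM.
  apply: (@le_trans _ _ (n%:R * (n%:R * (t N w * t N w)) * t N w)); first by rewrite ler_pM.
  by rewrite -!mulrA ler_wpM2l// ler_wpM2l// mulrA cube_le.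
Qed.

Let eps_ttp a b : dominated (fun N w => eps N * (t N w ^+ 2 * p N w a b)) (fun=> 0).
Proof.
apply: (@dominated_eps _ (fun w => t0 w ^+ 2 * p0 w a b) 1) => [N|w rw||N w].
- by apply: measurable_funM; [exact: measurable_funX|exact: mp].
- by apply: cvgM; [exact: (cvgM (t_cvg rw) (t_cvg rw))|exact: p_cvg].
- exact: ler01.
- rewrite normrM mul1r (ger0_norm (sqr_ge0 _)).
  apply: le_trans (cube_le N w); rewrite expr2.
  by rewrite ler_wpM2l// mulr_ge0.
Qed.

Let dominated_ext f f0 f' f0' : dominated f f0 -> (forall N w, f N w = f' N w) ->
  (forall w, f0 w = f0' w) -> dominated f' f0'.
Proof.
move=> gf ff' f0f0'; rewrite (_ : f' = f) 1?(_ : f0' = f0)//; apply/funext => w //.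
by apply/funext.
Qed.

Let Pi := orth_proj A.

(** The limit of [ridge_proj_moment1]. *)
Lemma mean_sketched_proj a b :
  \int[P]_w ridge_proj A 0 (mxval S w) a b = theta1 R m d * orth_proj A a b.
Proof.
have gF : dominated (fun N w => (Pi - eps N *: p N w) a b) (fun=> Pi a b).
  apply: (dominated_ext (dominatedD (dominated_cst (Pi a b)) (dominatedZ (-1) (eps_p a b)))).
    by move=> N w; rewrite !mxE mulN1r.
  by move=> w; rewrite mulr0 addr0.
have gG : dominated (fun N w => ((k - 1) *: p N w + eps N *: (p N w *m p N w) +
    (eps N * t N w) *: p N w) a b) (fun w => (k - 1) * p0 w a b).
  apply: (dominated_ext (dominatedD (dominatedD (dominatedZ (k - 1) (dominated_p a b))
    (eps_pp a b)) (eps_tp a b))).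
    by move=> N w; rewrite [RHS]mxE [X in _ = X + _]mxE !(mxE, mulrA).
  by move=> w; rewrite !addr0.
have := dominated_eq gF gG (fun N => ridge_proj_moment1 m_gt0 S_gauss A_full (eps_gt0 N) a b).
rewrite Rintegral_cst// [X in fine X](probability_setT P) mulr1.
rewrite RintegralZl//; last by have [] := dominated_cvg (dominated_p a b).
rewrite -/(p0 _) => ->; rewrite /theta1 -/k.
have k1 : k - 1 != 0 by rewrite gt_eqF//; have := k4; lra.
by field; rewrite k1 pnatr_eq0 -lt0n m_gt0.
Qed.

Lemma integrable_sqr_tr_sketched_proj :
  P.-integrable setT (fun w => (\tr (ridge_proj A 0 (mxval S w)) ^+ 2)%:E).
Proof. exact: It02. Qed.

Lemma integrable_sketched_proj a b :
  P.-integrable setT (fun w => (ridge_proj A 0 (mxval S w) a b)%:E).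
Proof. by have [] := dominated_cvg (dominated_p a b). Qed.

Lemma integrable_sqr_sketched_proj a b : P.-integrable setT (fun w =>
  ((ridge_proj A 0 (mxval S w) *m ridge_proj A 0 (mxval S w)) a b)%:E).
Proof. by have [] := dominated_cvg (dominated_pp a b). Qed.

Let mean_t0 : \int[P]_w t0 w = theta1 R m d * d%:R.
Proof.
rewrite /t0 /mxtrace Rintegral_sum => [|i]; last exact: integrable_sketched_proj.
rewrite -(tr_orth_proj A_full) /mxtrace mulr_sumr.
by apply: eq_bigr => i _; exact: mean_sketched_proj.
Qed.

(** The limits of [ridge_proj_moment2] and [ridge_proj_moment3] are linear in
    the means of [P^2] and [tr(P) P]; the latter is eliminated. *)
Lemma mean_sqr_sketched_proj a b :
  \int[P]_w (ridge_proj A 0 (mxval S w) *m ridge_proj A 0 (mxval S w)) a b =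
  theta2 R m d * orth_proj A a b.
Proof.
pose gpp := dominated_pp a b; pose gtp := dominated_tp a b.
have Ipp := (dominated_cvg gpp).1; have Itp := (dominated_cvg gtp).1.
have It := (dominated_cvg dominated_t).1.
have gF2 : dominated (fun N w => (p N w - eps N *: (p N w *m p N w)) a b)
    (fun w => p0 w a b).
  apply: (dominated_ext (dominatedD (dominated_p a b) (dominatedZ (-1) (eps_pp a b)))).
    by move=> N w; rewrite [RHS]mxE [X in _ = _ + X]mxE [X in _ = _ - X]mxE mulN1r.
  by move=> w; rewrite mulr0 addr0.
have gG2 : dominated (fun N w => ((k - 2) *: (p N w *m p N w) - t N w *: p N w +
     eps N *: (2 *: (p N w *m p N w *m p N w) + t N w *: (p N w *m p N w) +
          \tr (p N w *m p N w) *: p N w)) a b)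
    (fun w => (k - 2) * (p0 w *m p0 w) a b + (-1) * (t0 w * p0 w a b)).
  apply: (dominated_ext (dominatedD (dominatedD (dominatedZ (k - 2) gpp) (dominatedZ (-1) gtp))
    (dominatedD (dominatedD (dominatedZ 2 (eps_ppp a b)) (eps_tpp a b)) (eps_sp a b)))).
    move=> N w; move: (p N w *m p N w *m p N w) (p N w *m p N w) => Z Y.
    by rewrite !mxE; ring.
  by move=> w; rewrite mulr0 !addr0.
have gF3 : dominated (fun N w => (t N w *: (Pi - eps N *: p N w)) a b)
    (fun w => Pi a b * t0 w).
  apply: (dominated_ext (dominatedD (dominatedZ (Pi a b) dominated_t)
    (dominatedZ (-1) (eps_tp a b)))).
    by move=> N w; rewrite !mxE; ring.
  by move=> w; rewrite mulr0 addr0.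
have gG3 : dominated (fun N w => (((k - 1) * t N w) *: p N w - 2 *: (p N w *m p N w) +
     eps N *: (t N w *: (p N w *m p N w) + t N w ^+ 2 *: p N w +
          2 *: (p N w *m p N w *m p N w))) a b)
    (fun w => (k - 1) * (t0 w * p0 w a b) + (-2) * (p0 w *m p0 w) a b).
  apply: (dominated_ext (dominatedD (dominatedD (dominatedZ (k - 1) gtp) (dominatedZ (-2) gpp))
    (dominatedD (dominatedD (eps_tpp a b) (eps_ttp a b)) (dominatedZ 2 (eps_ppp a b))))).
    move=> N w; move: (p N w *m p N w *m p N w) (p N w *m p N w) => Z Y.
    by rewrite !mxE; ring.
  by move=> w; rewrite mulr0 !addr0.
have := dominated_eq gF2 gG2
  (fun N => ridge_proj_moment2 m_gt0 S_gauss A_full (eps_gt0 N) a b).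
have := dominated_eq gF3 gG3
  (fun N => ridge_proj_moment3 m_gt0 S_gauss A_full (eps_gt0 N) a b).
rewrite !RintegralD//; try exact: integrable_RZ.
rewrite !RintegralZl// mean_t0 mean_sketched_proj -/(Pi) -/(p0 _).
set X := \int[P]_w (p0 w *m p0 w) a b; set Y := \int[P]_w (t0 w * p0 w a b).
rewrite -[X in _ -> _ -> X = _]/X.
have k1 : k - 1 != 0 by rewrite gt_eqF//; have := k4; lra.
have k0 : k != 0 by rewrite gt_eqF//; have := k4; lra.
have k3 : k - 3 != 0 by rewrite gt_eqF//; have := k4; lra.
have mn0 : m%:R != 0 :> R by rewrite pnatr_eq0 -lt0n m_gt0.
rewrite /theta1 /theta2 -/k => E3 E2.
have dk : d%:R = m%:R - k by rewrite /k; ring.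
have EX : m%:R^-1 * (k * (k - 3)) * X =
    (k - 1) * (m%:R / (k - 1) * Pi a b) + Pi a b * (m%:R / (k - 1) * d%:R).
  by rewrite E2 E3; ring.
apply: (mulfI (x := m%:R^-1 * (k * (k - 3)))).
  by rewrite !mulf_neq0// invr_eq0.
by rewrite EX dk; field; rewrite k0 k1 k3 mn0.
Qed.

End Limit.

(** * Independent sketches *)

Section IndependentSketches.
Variables (disp : measure_display) (T : measurableType disp) (R : realType).
Variables (P : probability T R) (m n : nat) (S1 S2 : randmx P m n).
Hypothesis S12_indep : forall A B, mx_events S1 A -> mx_events S2 B ->
  (P (A `&` B) = P A * P B)%E.

Let gen (S : randmx P m n) :=
  \bigcup_(ij in [set: 'I_m * 'I_n]) rv_events (S ij.1 ij.2).

Let gen_measurable S A : <<s gen S >> A -> measurable A.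
Proof.
apply: smallest_sub; first exact: sigma_algebra_measurable.
by move=> B [ij _]; exact: rv_events_measurable.
Qed.

Let m_id S : measurable_fun (setT : set T) (id : T -> g_sigma_algebraType (gen S)).
Proof. by move=> _ A mA; rewrite setTI; exact: (@gen_measurable S). Qed.

Let idm S : {mfun T >-> g_sigma_algebraType (gen S)} :=
  HB.pack (id : T -> g_sigma_algebraType (gen S)) (isMeasurableFun.Build _ _ _ _ _ (@m_id S)).

Let m_entry S i j : measurable_fun setT
  (fun y : g_sigma_algebraType (gen S) => mxval S (y : T) i j).
Proof.
rewrite (_ : (fun y => _) = (fun y : g_sigma_algebraType (gen S) => S i j y)).
  move=> _ B mB; apply: sub_sigma_algebra; exists (i, j) => //.
  by exists B.
by apply/funext => y; rewrite mxE.
Qed.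

Variables f g : 'M[R]_(m, n) -> R.
Hypotheses (bf : mx_borel f) (bg : mx_borel g).
Hypothesis If : P.-integrable setT (fun w => (f (mxval S1 w))%:E).
Hypothesis Ig : P.-integrable setT (fun w => (g (mxval S2 w))%:E).
Hypothesis Ifg :
  P.-integrable setT (fun w => (f (mxval S1 w) * g (mxval S2 w))%:E).

Lemma Rintegral_indepM : \int[P]_w (f (mxval S1 w) * g (mxval S2 w)) =
  \int[P]_w f (mxval S1 w) * \int[P]_w g (mxval S2 w).
Proof.
pose F (z : g_sigma_algebraType (gen S1) * g_sigma_algebraType (gen S2)) :=
  (f (mxval S1 (z.1 : T)) * g (mxval S2 (z.2 : T)))%:E.
have mf : measurable_fun setT (fun y : g_sigma_algebraType (gen S1) => (f (mxval S1 (y : T)))).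
  by apply: bf => i j; exact: m_entry.
have mg : measurable_fun setT (fun y : g_sigma_algebraType (gen S2) => (g (mxval S2 (y : T)))).
  by apply: bg => i j; exact: m_entry.
have mF : measurable_fun setT F.
  apply/measurable_EFinP; apply: measurable_funM.
    exact: (measurableT_comp mf measurable_fst).
  exact: (measurableT_comp mg measurable_snd).
have ind A B : measurable A -> measurable B ->
    (P (idm S1 @^-1` A `&` idm S2 @^-1` B) = P (idm S1 @^-1` A) * P (idm S2 @^-1` B))%E.
  by move=> mA mB; exact: S12_indep.
have E := integral_indep ind mF Ifg.
have Ef : (\int[distribution P (idm S1)]_x (f (mxval S1 (x : T)))%:E =
    \int[P]_w (f (mxval S1 w))%:E)%E.
  by rewrite integral_distribution//; exact/measurable_EFinP.
have Eg : (\int[distribution P (idm S2)]_x (g (mxval S2 (x : T)))%:E =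
    \int[P]_w (g (mxval S2 w))%:E)%E.
  by rewrite integral_distribution//; exact/measurable_EFinP.
have If' : (distribution P (idm S1)).-integrable setT (fun x => (f (mxval S1 (x : T)))%:E).
  by apply: integrable_pushforward => //; exact/measurable_EFinP.
have Ig' : (distribution P (idm S2)).-integrable setT (fun x => (g (mxval S2 (x : T)))%:E).
  by apply: integrable_pushforward => //; exact/measurable_EFinP.
rewrite /Rintegral E /F /=.
under eq_integral => y _.
  under eq_integral do rewrite EFinM.
  rewrite integralZr//= Ef -[X in (X * _)%E]fineK; last exact: integrable_fin_num.
  over.
by rewrite integralZl//= Eg fineM//; exact: integrable_fin_num.
Qed.

End IndependentSketches.

(** * The least squares problem and the workers *)

Section LeastSquares.
Variable R : realType.

(** The choice [h = - a / (1 + c)] makes the polynomial negative unless [a] is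
    zero. *)
Lemma linear_coef_eq0 (a c : R) : 0 <= c ->
  (forall h, 0 <= h * a + h ^+ 2 * c) -> a = 0.
Proof.
move=> c0 /(_ (- a / (1 + c))).
have c1 : 0 < 1 + c by lra.
rewrite (_ : _ + _ = - (a / (1 + c)) ^+ 2); last by field; rewrite gt_eqF.
rewrite oppr_ge0 => h.
have /eqP : (a / (1 + c)) ^+ 2 = 0 by apply/eqP; rewrite eq_le h sqr_ge0.
by rewrite sqrf_eq0 mulf_eq0 invr_eq0 (gt_eqF c1) orbF => /eqP.
Qed.

Lemma sqnorm2D n (u v : 'cV[R]_n) (h : R) :
  sqnorm2 (u + h *: v) = sqnorm2 u + h * (2 * (v^T *m u) 0 0) + h ^+ 2 * sqnorm2 v.
Proof.
rewrite /sqnorm2 mxE !mulr_sumr -!big_split /=; apply: eq_bigr => i _.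
by rewrite !mxE; ring.
Qed.

Lemma col_orth_eq0 n (u : 'cV[R]_n) : (forall v : 'cV[R]_n, (v^T *m u) 0 0 = 0) -> u = 0.
Proof. by move=> /(_ u) /eqP; rewrite -sqnorm2E sqnorm2_eq0 => /eqP. Qed.

Lemma normal_equation n d (A : 'M[R]_(n, d)) (b : 'cV[R]_n) x :
  is_argmin (fun x : 'cV[R]_d => sqnorm2 (A *m x - b)) x -> A^T *m (A *m x - b) = 0.
Proof.
move=> xmin; apply: col_orth_eq0 => v.
have : 2 * ((A *m v)^T *m (A *m x - b)) 0 0 = 0.
  apply: (linear_coef_eq0 (sqnorm2_ge0 (A *m v))) => h.
  have /= := xmin (x + h *: v).
  rewrite [A *m (x + _)]mulmxDr -scalemxAr addrAC sqnorm2D.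
  by rewrite -addrA lerDl.
by rewrite trmx_mul -mulmxA => /eqP; rewrite mulf_eq0 pnatr_eq0 /= => /eqP.
Qed.

Lemma worker_normal_equation m d (X : 'M[R]_(m, d)) (g D : 'cV[R]_d) :
  is_argmin (worker_objective X g) D -> X^T *m X *m D = - g.
Proof.
move=> Dmin; apply/eqP; rewrite -subr_eq0 opprK; apply/eqP.
apply: col_orth_eq0 => v.
apply: (@linear_coef_eq0 _ (2^-1 * sqnorm2 (X *m v))).
  by rewrite mulr_ge0 ?sqnorm2_ge0// invr_ge0.
move=> h; have := Dmin (D + h *: v); rewrite /worker_objective.
rewrite [X *m (D + _)]mulmxDr -scalemxAr sqnorm2D.
have gv : (g^T *m v) 0 0 = (v^T *m g) 0 0.
  by rewrite -[in RHS](trmxK g) -trmx_mul [RHS]mxE.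
have -> : (g^T *m (D + h *: v)) 0 0 = (g^T *m D) 0 0 + h * (v^T *m g) 0 0.
  by rewrite mulmxDr -scalemxAr mxE [X in _ + X = _]mxE gv.
have -> : (v^T *m (X^T *m X *m D + g)) 0 0 =
    ((X *m v)^T *m (X *m D)) 0 0 + (v^T *m g) 0 0.
  by rewrite mulmxDr mxE trmx_mul !mulmxA.
by rewrite -subr_ge0; congr (_ <= _); field.
Qed.

End LeastSquares.

(** * The error recursion *)

Section WorkerStep.
Variables (R : realType) (m n d : nat) (A : 'M[R]_(n, d)).
Implicit Type M : 'M[R]_(m, n).

(** If the Gram matrix is singular, [invmx] returns the matrix itself, which is
    positive semidefinite as well. *)
Lemma sketched_proj_psd M : psd (ridge_proj A 0 M).
Proof.
have [u|nu] := boolP (ridge_gram A 0 M \in unitmx); first exact: ridge_proj_psd.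
rewrite ridge_projE /invmx (negbTE nu); apply: psd_congr.
by rewrite ridge_gramE scale0r addr0; exact: psd_gram.
Qed.

Lemma worker_step (M : 'M[R]_(m, n)) (v : 'cV[R]_n) D :
  ridge_gram A 0 M \in unitmx ->
  is_argmin (worker_objective (M *m A) (A^T *m v)) D ->
  A *m D = - (ridge_proj A 0 M *m v).
Proof.
move=> u /worker_normal_equation.
have -> : (M *m A)^T *m (M *m A) = ridge_gram A 0 M.
  by rewrite ridge_gramE scale0r addr0.
move=> WD; rewrite -[D](mulKmx u) WD ridge_projE.
by rewrite !mulmxN !mulmxA.
Qed.

End WorkerStep.

Section ProjectedError.
Variables (disp : measure_display) (T : measurableType disp) (R : realType).
Variables (P : probability T R) (q m n d : nat) (S : 'I_q -> randmx P m n).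
Hypothesis m_gt : (d + 3 < m)%N.
Hypothesis S_iid : iid_gaussian_sketches S.
Variables (A : 'M[R]_(n, d)).
Hypothesis A_full : \rank A = d.
Variables (v : 'cV[R]_n).
Hypothesis v_range : orth_proj A *m v = v.

(** The step of worker [k], up to sign, seen in the column space of [A]. *)
Definition proj_err k w : 'cV[R]_n := ridge_proj A 0 (mxval (S k) w) *m v.
Local Notation y := proj_err.

Let gauss k : gaussian_sketch (S k). Proof. by have [] := S_iid. Qed.

Let t k w := \tr (ridge_proj A 0 (mxval (S k) w)).

Let t_ge0 k w : 0 <= t k w. Proof. exact/psd_tr_ge0/sketched_proj_psd. Qed.

Lemma mx_measurable_proj_err k : mx_measurable (y k).
Proof.
apply: mx_measurable_mul; last exact: mx_measurable_cst.
by apply: mx_measurable_ridge_proj => i j; exact: measurable_mxval.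
Qed.

Let L := \sum_b `|v b 0|.

Let y_le k w a : `|y k w a 0| <= t k w * L.
Proof.
rewrite mxE (le_trans (ler_norm_sum _ _ _))// mulr_sumr; apply: ler_sum => b _.
by rewrite normrM ler_wpM2r// psd_entry_le_tr//; exact: sketched_proj_psd.
Qed.

Lemma integrable_proj_err k a : P.-integrable setT (fun w => (y k w a 0)%:E).
Proof.
apply: (eq_integrable measurableT
  (EFin \o (fun w => \sum_b v b 0 * ridge_proj A 0 (mxval (S k) w) a b))).
  by move=> w _ /=; rewrite mxE; congr EFin; apply: eq_bigr => b _; rewrite mulrC.
apply: integrable_Rsum => b; apply: integrable_RZ.
exact: (integrable_sketched_proj m_gt (gauss k) A_full).
Qed.

Lemma integrable_proj_errM k l a b :
  P.-integrable setT (fun w => (y k w a 0 * y l w b 0)%:E).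
Proof.
have It k' := integrable_sqr_tr_sketched_proj m_gt (gauss k') A_full.
have := @integrable_RZ _ _ _ P (L ^+ 2) (fun w => t k w ^+ 2 + t l w ^+ 2).
have Is : P.-integrable setT (EFin \o (fun w => t k w ^+ 2 + t l w ^+ 2)).
  by have := integrableD measurableT (It k) (It l); apply: eq_integrable.
move=> /(_ Is); apply: le_integrable => //.
  by apply/measurable_EFinP; apply: measurable_funM; exact: mx_measurable_proj_err.
move=> w _; rewrite /= lee_fin normrM (le_trans _ (ler_norm _))//.
have L0 : 0 <= L by exact: sumr_ge0.
apply: (@le_trans _ _ ((t k w * L) * (t l w * L))); first by rewrite ler_pM.
rewrite (_ : _ * _ = L ^+ 2 * (t k w * t l w)); last by ring.
rewrite ler_wpM2l ?sqr_ge0//.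
have := sqr_ge0 (t k w - t l w); have := t_ge0 k w; have := t_ge0 l w; nra.
Qed.

Lemma mean_proj_err k a : \int[P]_w y k w a 0 = theta1 R m d * v a 0.
Proof.
rewrite (@eq_Rintegral _ _ _ P setT
  (fun w => \sum_b v b 0 * ridge_proj A 0 (mxval (S k) w) a b)); last first.
  by move=> w _; rewrite mxE; apply: eq_bigr => b _; rewrite mulrC.
have Ip b := integrable_sketched_proj m_gt (gauss k) A_full a b.
rewrite Rintegral_sum => [|b]; last by apply: integrable_RZ; exact: Ip.
rewrite -[in RHS]v_range mxE mulr_sumr; apply: eq_bigr => b _.
rewrite RintegralZl; [|by []|exact: Ip].
by rewrite (mean_sketched_proj m_gt (gauss k) A_full) mulrCA [v b 0 * _]mulrC.
Qed.

Lemma mean_sqnorm2_proj_err k :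
  \sum_a \int[P]_w (y k w a 0 * y k w a 0) = theta2 R m d * sqnorm2 v.
Proof.
pose pp w := ridge_proj A 0 (mxval (S k) w) *m ridge_proj A 0 (mxval (S k) w).
rewrite -Rintegral_sum => [|a]; last exact: integrable_proj_errM.
rewrite (@eq_Rintegral _ _ _ P setT
  (fun w => \sum_a \sum_b (v a 0 * v b 0) * pp w a b)); last first.
  move=> w _; transitivity ((v^T *m (pp w *m v)) 0 0).
    have -> : v^T *m (pp w *m v) = (y k w)^T *m y k w.
      by rewrite /y /pp trmx_mul ridge_proj_sym !mulmxA.
    by rewrite mxE; apply: eq_bigr => a _; rewrite [X in _ = X * _]mxE.
  rewrite mxE; apply: eq_bigr => a _; rewrite [(_^T) _ _]mxE mxE mulr_sumr.
  by apply: eq_bigr => b _; ring.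
have Ipp a b := integrable_sqr_sketched_proj m_gt (gauss k) A_full a b.
have Iv a b : P.-integrable setT (EFin \o (fun w => (v a 0 * v b 0) * pp w a b)).
  by apply: integrable_RZ; exact: Ipp.
rewrite Rintegral_sum => [|a]; last exact: integrable_Rsum.
transitivity (\sum_a \sum_b (v a 0 * v b 0) * (theta2 R m d * orth_proj A a b)).
  apply: eq_bigr => a _; rewrite Rintegral_sum//; apply: eq_bigr => b _.
  rewrite RintegralZl; [|by []|exact: Ipp].
  by rewrite (mean_sqr_sketched_proj m_gt (gauss k) A_full).
rewrite /sqnorm2 mulr_sumr; apply: eq_bigr => a _.
have va : v a 0 = \sum_b orth_proj A a b * v b 0 by rewrite -{1}v_range mxE.
by rewrite expr2 [X in _ = _ * (_ * X)]va !mulr_sumr; apply: eq_bigr => b _; ring.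
Qed.

Lemma mean_proj_errM k l a : k != l ->
  \int[P]_w (y k w a 0 * y l w a 0) = theta1 R m d ^+ 2 * v a 0 ^+ 2.
Proof.
move=> kl; pose f (M : 'M[R]_(m, n)) := (ridge_proj A 0 M *m v) a 0.
have bf : mx_borel f.
  move=> d0 T0 M mM; apply: mx_measurable_mul; last exact: mx_measurable_cst.
  exact: mx_measurable_ridge_proj.
have ind B C : mx_events (S k) B -> mx_events (S l) C ->
    (P (B `&` C) = P B * P C)%E.
  move=> kB lC; have [_ I] := S_iid.
  have := I [set k; l]%SET (fun i => if i == k then B else C).
  rewrite big_setU1 ?inE//= big_set1 eqxx eq_sym (negbTE kl) => <-.
    congr (P _); apply/seteqP; split => [w [Bw Cw] i /=|w h].
      by rewrite !inE; case: eqP => // _ /= /eqP ->.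
    have hk := h k; have hl := h l; rewrite /= !inE !eqxx orbT /= in hk hl.
    by split; [exact: hk|move: hl; rewrite eq_sym (negbTE kl); exact].
  by move=> i; rewrite !inE; case: eqP => [->//|_ /= /eqP ->].
have := @Rintegral_indepM _ _ _ P m n (S k) (S l) ind f f bf bf
  (integrable_proj_err k a) (integrable_proj_err l a) (integrable_proj_errM k l a a).
by rewrite /f -/(y k _) => ->; rewrite !mean_proj_err; ring.
Qed.

End ProjectedError.

Section MeanSquaredError.
Variables (disp : measure_display) (T : measurableType disp) (R : realType).
Variables (P : probability T R) (q m n d : nat) (S : 'I_q -> randmx P m n).
Hypothesis q_gt0 : (0 < q)%N.
Hypothesis m_gt : (d + 3 < m)%N.
Hypothesis S_iid : iid_gaussian_sketches S.
Variables (A : 'M[R]_(n, d)).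
Hypothesis A_full : \rank A = d.
Variables (v : 'cV[R]_n).
Hypothesis v_range : orth_proj A *m v = v.
Local Notation y := (proj_err S A v).
Local Notation th1 := (theta1 R m d).
Local Notation th2 := (theta2 R m d).

Let sqr_expand c w : sqnorm2 (v - c *: \sum_k y k w) =
  \sum_a (v a 0 ^+ 2 + ((- 2 * c * v a 0) * (\sum_k y k w a 0) +
          c ^+ 2 * \sum_k \sum_l (y k w a 0 * y l w a 0))).
Proof.
apply: eq_bigr => a _; rewrite !mxE summxE.
rewrite (_ : \sum_k \sum_l _ = (\sum_k y k w a 0) * (\sum_k y k w a 0)).
  by ring.
by rewrite big_distrlr.
Qed.

Let Iy k a := integrable_proj_err m_gt S_iid A_full v k a.
Let Iyy k l a := integrable_proj_errM m_gt S_iid A_full v k l a a.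

Let Isum a : P.-integrable setT (EFin \o (fun w => \sum_k y k w a 0)).
Proof. by apply: integrable_Rsum => k; exact: Iy. Qed.

Let Isum2 a : P.-integrable setT
  (EFin \o (fun w => \sum_k \sum_l (y k w a 0 * y l w a 0))).
Proof. by do 2 apply: integrable_Rsum => ?; exact: Iyy. Qed.

Let Icst (c : R) : P.-integrable setT (EFin \o (fun _ : T => c)).
Proof. exact: finite_measure_integrable_cst. Qed.

Let Iterm c a : P.-integrable setT (EFin \o (fun w =>
  (- 2 * c * v a 0) * (\sum_k y k w a 0) +
          c ^+ 2 * \sum_k \sum_l (y k w a 0 * y l w a 0))).
Proof.
have := integrableD measurableT (integrable_RZ (- 2 * c * v a 0) (Isum a))
  (integrable_RZ (c ^+ 2) (Isum2 a)).
by apply: eq_integrable.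
Qed.

Let Iterm' c a : P.-integrable setT (EFin \o (fun w => v a 0 ^+ 2 +
  ((- 2 * c * v a 0) * (\sum_k y k w a 0) +
          c ^+ 2 * \sum_k \sum_l (y k w a 0 * y l w a 0)))).
Proof.
have := integrableD measurableT (Icst (v a 0 ^+ 2)) (Iterm c a).
by apply: eq_integrable.
Qed.

Lemma integrable_sqnorm2_step c : P.-integrable setT
  (fun w => (sqnorm2 (v - c *: \sum_k y k w))%:E).
Proof.
under eq_fun do rewrite sqr_expand.
by apply: integrable_Rsum => a; exact: Iterm'.
Qed.

(** In the expansion of the square, the [q] diagonal terms bring [theta2] and, by
    independence, the [q * (q - 1)] other ones [theta1 ^ 2]. *)
Lemma mean_sqnorm2_step c :
  \int[P]_w sqnorm2 (v - c *: \sum_k y k w) =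
  (1 - 2 * c * q%:R * th1 +
   c ^+ 2 * (q%:R * th2 + q%:R * (q%:R - 1) * th1 ^+ 2)) * sqnorm2 v.
Proof.
under eq_Rintegral do rewrite sqr_expand.
rewrite Rintegral_sum => [|a]; last exact: Iterm'.
have E a : \int[P]_w (v a 0 ^+ 2 + ((- 2 * c * v a 0) * (\sum_k y k w a 0) +
          c ^+ 2 * \sum_k \sum_l (y k w a 0 * y l w a 0))) =
    v a 0 ^+ 2 + ((- 2 * c * q%:R * th1) * v a 0 ^+ 2 +
          c ^+ 2 * \sum_k \sum_l \int[P]_w (y k w a 0 * y l w a 0)).
  rewrite RintegralD; [|by []|exact: Icst|exact: Iterm].
  rewrite Rintegral_cst// [X in fine X](probability_setT P) mulr1.
  rewrite RintegralD; [|by []|apply: integrable_RZ; exact: Isum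
                       |apply: integrable_RZ; exact: Isum2].
  rewrite (RintegralZl _ measurableT (Isum a)) (RintegralZl _ measurableT (Isum2 a)).
  rewrite Rintegral_sum => [|k]; last exact: Iy.
  rewrite Rintegral_sum => [|k]; last by apply: integrable_Rsum => l; exact: Iyy.
  congr (_ + (_ + _ * _)).
    under eq_bigr do rewrite (mean_proj_err m_gt S_iid A_full v_range).
    by rewrite sumr_const card_ord -(mulr_natr (_ * _)); ring.
  by apply: eq_bigr => k _; rewrite Rintegral_sum// => l; exact: Iyy.
under eq_bigr do rewrite E.
rewrite !big_split /= -!mulr_sumr -/(sqnorm2 v).
have -> : \sum_a \sum_k \sum_l \int[P]_w (y k w a 0 * y l w a 0) =
    (q%:R * th2 + q%:R * (q%:R - 1) * th1 ^+ 2) * sqnorm2 v.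
  rewrite exchange_big /=.
  transitivity (\sum_(k < q) (th2 + (q%:R - 1) * th1 ^+ 2) * sqnorm2 v).
    apply: eq_bigr => k _; rewrite exchange_big (bigD1 k)//=.
    rewrite (mean_sqnorm2_proj_err m_gt S_iid A_full v_range) mulrDl; congr (_ + _).
    transitivity (\sum_(l < q | l != k) th1 ^+ 2 * sqnorm2 v).
      apply: eq_bigr => l lk; rewrite /sqnorm2 mulr_sumr; apply: eq_bigr => a _.
      by rewrite (mean_proj_errM m_gt S_iid A_full v_range) 1?eq_sym.
    have qm : q.-1%:R = q%:R - 1 :> R by rewrite -subn1 natrB.
    by rewrite sumr_const cardC1 card_ord -[LHS]mulr_natl qm; ring.
  by rewrite sumr_const card_ord -[LHS]mulr_natl; ring.
ring.
Qed.

End MeanSquaredError.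

Theorem mainTheorem6 (disp : measure_display) (T : measurableType disp)
  (R : realType) (P : probability T R) (q m n d : nat)
  (A : 'M[R]_(n, d)) (b : 'cV[R]_n)
  (xstar xt : 'cV[R]_d)
  (S : 'I_q -> randmx P m n) (Delta : 'I_q -> randmx P d 1)
  (q_gt0 : (0 < q)%N)
  (m_gt : (d + 3 < m)%N)
  (A_full : \rank A = d)
  (xstar_argmin : is_argmin (fun x : 'cV[R]_d => sqnorm2 (A *m x - b)) xstar)
  (S_iid : iid_gaussian_sketches S)
  (Delta_argmin : worker_solutions A b xt S Delta) :
  let mu : R := 1 / theta1 R m d in
  let xt1 (w : T) : 'cV[R]_d :=
    master_update mu xt (fun k => mxval (Delta k) w) in
  ('E_P[(fun w => sqnorm2 (A *m (xt1 w - xstar)))] =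
   ((1 / q%:R) * (theta2 R m d / theta1 R m d ^+ 2 - 1)
      * sqnorm2 (A *m (xt - xstar)))%:E)%E.
Proof.
move=> mu xt1; set v := A *m (xt - xstar).
have v_range : orth_proj A *m v = v by rewrite /v mulmxA orth_projA.
pose c := mu * q%:R^-1.
have grad : ls_gradient A b xt = A^T *m v.
  rewrite /ls_gradient /v [A *m (xt - _)]mulmxBr -[RHS]addr0 -(normal_equation xstar_argmin).
  by rewrite -mulmxDr; congr (_ *m _); rewrite addrA subrK.
have step : {ae P, forall w,
    A *m (xt1 w - xstar) = v - c *: \sum_k proj_err S A v k w}.
  have all_workers : {ae P, forall w, forall k, sketch_injective (S k) A w /\
      is_argmin (worker_objective (mxval (S k) w *m A) (ls_gradient A b xt))
        (mxval (Delta k) w)}.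
    apply: filter_forall => k; apply: filterI (Delta_argmin k).
    have [S_gauss _] := S_iid.
    exact: (ae_sketch_injective m_gt (S_gauss k) A_full).
  apply: filterS all_workers => w hw.
  rewrite /xt1 /master_update addrAC mulmxDr -/v -scalemxAr mulmx_sumr.
  rewrite -/c -scalerN -sumrN; congr (_ + _ *: _); apply: eq_bigr => k _.
  have [inj] := hw k; rewrite grad => /(worker_step inj) ->.
  by [].
have th1 : theta1 R m d != 0.
  rewrite /theta1 mulf_neq0// ?invr_eq0.
    by rewrite pnatr_eq0; case: m m_gt {S S_iid Delta_argmin mu xt1 c step}.
  by rewrite gt_eqF//; have := @codim_ge4 R m d m_gt; lra.
rewrite unlock.
transitivity (\int[P]_w (sqnorm2 (v - c *: \sum_k proj_err S A v k w))%:E)%E.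
  apply: ae_eq_integral => //.
  - apply/measurable_EFinP; apply: measurable_sum => a; apply: measurable_funX.
    apply: mx_measurable_mul; first exact: mx_measurable_cst.
    apply: mx_measurableD; last exact: mx_measurable_cst.
    apply: mx_measurableD; first exact: mx_measurable_cst.
    move=> i j; under eq_fun do rewrite mxE summxE.
    apply: measurable_funM; first exact: measurable_cst.
    by apply: measurable_sum => k; exact: measurable_mxval.
  - exact: measurable_int (integrable_sqnorm2_step m_gt S_iid A_full v c).
  - by apply: filterS step => w -> _.
have I := integrable_sqnorm2_step m_gt S_iid A_full v c.
rewrite -[LHS]fineK; last exact: integrable_fin_num.
congr EFin; rewrite -[LHS]/(\int[P]_w _) mean_sqnorm2_step//.
have qn0 : q%:R != 0 :> R by rewrite pnatr_eq0 -lt0n.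
by congr (_ * _); rewrite /c /mu; field; rewrite th1 qn0.
Qed.
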